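(* Let $n\geq 1$ be an integer and let $\mathbf{M}$ be a random $n\times n$ Markov matrix, i.e. a random element of $\mathcal{M}_n$. Then $\mathbf{M}\sim\mathcal{U}(\mathcal{M}_n)$ if and only if the rows of $\mathbf{M}$ are i.i.d. and follow the Dirichlet law $\mathcal{D}_n(1,\ldots,1)$ (which has mean $(\frac1n,\ldots,\frac1n)$). Moreover, the probability distribution $\mathcal{U}(\mathcal{M}_n)$ is invariant under permutations of rows and under permutations of columns.
   Context: A real $n\times n$ matrix is Markov if its entries are non-negative and each row sums to $1$, i.e. each row belongs to the simplex $\Lambda_n=\{(x_1,\ldots,x_n)\in[0,1]^n : x_1+\cdots+x_n=1\}$. $\mathcal{M}_n$ denotes the set of all $n\times n$ Markov matrices; it is a compact convex polytope in $\mathbb{R}^{n^2}$ of dimension $n(n-1)$. The uniform distribution $\mathcal{U}(\mathcal{M}_n)$ on $\mathcal{M}_n$ is the normalized trace on $\mathcal{M}_n$ of the Lebesgue measure of $\mathbb{R}^{n^2}$, i.e. the probability measure obtained by normalizing the restriction to $\mathcal{M}_n$ of the $n(n-1)$-dimensional Hausdorff measure (equivalently, the Lebesgue measure of the affine hull of $\mathcal{M}_n$). For $a\in(0,\infty)^n$, the Dirichlet distribution $\mathcal{D}_n(a_1,\ldots,a_n)$ on $\Lambda_n$ is the law of $\left(\frac{G_1}{G_1+\cdots+G_n},\ldots,\frac{G_n}{G_1+\cdots+G_n}\right)$ where $G_1,\ldots,G_n$ are independent and $G_i$ has the Gamma density $t\mapsto \frac{1}{\Gamma(a_i)}t^{a_i-1}e^{-t}\mathbf{1}_{(0,\infty)}(t)$.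 *)

(* Defs.v *)
From HB Require Import structures.
From mathcomp Require Import all_boot all_order all_algebra perm.
From mathcomp Require Import all_classical all_reals all_analysis.

Set Implicit Arguments.
Unset Strict Implicit.
Unset Printing Implicit Defensive.

Import Order.TTheory GRing.Theory Num.Theory numFieldNormedType.Exports.

Local Open Scope classical_set_scope.
Local Open Scope ring_scope.

(* The Borel structure on matrices; n-vectors are the rows 'rV_n. *)
Definition borel_mx (R : realType) (m n : nat) : measurableType _ :=
  g_sigma_algebraType (@open 'M[R]_(m, n)).

(* The library norm of a matrix is the sup norm; Hausdorff measures on
   R^(m * n) refer to the Euclidean distance instead. *)
Definition eucl_dist (R : realType) (m n : nat) (A B : 'M[R]_(m, n)) : R :=
  Num.sqrt (\sum_(i < m) \sum_(j < n) (A i j - B i j) ^+ 2).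

(* The value is -oo on the empty set. *)
Definition diameter (R : realType) (m n : nat) (F : set 'M[R]_(m, n)) : \bar R :=
  ereal_sup [set (eucl_dist p.1 p.2)%:E | p in F `*` F].

(* diam(F)^d, with the conventions diam(set0)^d = 0 and, for F nonempty,
   diam(F)^0 = 1, so that the dimension 0 gives the counting measure. *)
Definition diam_pow (R : realType) (m n d : nat) (F : set 'M[R]_(m, n)) : \bar R :=
  if F == set0 then 0%E else (diameter F ^+ d)%E.

Definition hausdorff_pre (R : realType) (m n d : nat) (delta : R)
    (A : set 'M[R]_(m, n)) : \bar R :=
  ereal_inf [set (\sum_(0 <= k <oo) diam_pow d (F k))%E |
    F in [set F : nat -> set 'M[R]_(m, n) |
      A `<=` \bigcup_k F k /\ forall k, (diameter (F k) <= delta%:E)%E]].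

(* The d-dimensional Hausdorff (outer) measure, without the multiplicative
   constant that some authors insert: it cancels in [uniform_on]. *)
Definition hausdorff (R : realType) (m n d : nat) (A : set 'M[R]_(m, n)) : \bar R :=
  ereal_sup [set hausdorff_pre d delta A | delta in [set delta : R | 0 < delta]].

Definition uniform_on (R : realType) (m n d : nat) (K A : set 'M[R]_(m, n)) : \bar R :=
  (hausdorff d (A `&` K) / hausdorff d K)%E.

Definition simplex (R : realType) (n : nat) : set 'rV[R]_n :=
  [set x | (forall j, 0 <= x ord0 j <= 1) /\ \sum_(j < n) x ord0 j = 1].

Definition markov_matrices (R : realType) (n : nat) : set 'M[R]_n :=
  [set A | forall i, simplex (row i A)].

Definition uniform_markov (R : realType) (n : nat) : set 'M[R]_n -> \bar R :=
  uniform_on (n * n.-1)%N (@markov_matrices R n).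

Lemma continuous_row (R : realType) (m n : nat) (i : 'I_m) :
  continuous (row i : 'M[R]_(m, n) -> 'rV[R]_n).
Proof.
move=> A B [P PA sPB].
exists (fun i0 j => if i0 == i then P ord0 j else setT).
  move=> i0 j /=; case: eqP => [->|_]; last exact: filterT.
  by have := PA ord0 j; rewrite mxE.
move=> C hC; apply: sPB => k j; rewrite ord1 mxE.
by have := hC i j; rewrite eqxx.
Qed.

Lemma measurable_row (R : realType) (m n : nat) (i : 'I_m) :
  measurable_fun setT (row i : borel_mx R m n -> borel_mx R 1 n).
Proof.
apply: (@measurability _ _ (borel_mx R m n) (borel_mx R 1 n) setT (row i)
  (@open 'rV[R]_n)) => //.
move=> _ [U oU <-]; rewrite setTI; apply: sub_gen_smallest.
by move/continuousP: (@continuous_row R m n i); exact.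
Qed.

Section probability_notions.
Context d (T : measurableType d) (R : realType) (P : probability T R).

Lemma measurable_random_row m n (M : {RV P >-> borel_mx R m n}) (i : 'I_m) :
  measurable_fun setT (fun w => row i (M w) : borel_mx R 1 n).
Proof. exact: measurableT_comp (@measurable_row R m n i) (measurable_funPT M). Qed.

Definition random_row m n (M : {RV P >-> borel_mx R m n}) (i : 'I_m) :
  {RV P >-> borel_mx R 1 n} := mfun_Sub (mem_set (measurable_random_row M i)).

Definition independent_RVs (I : finType) d' (E : measurableType d')
    (X : I -> {RV P >-> E}) : Prop :=
  forall (J : {set I}) (B : I -> set E), (forall i, measurable (B i)) ->
    P (\bigcap_(i in [set i | i \in J]) (X i @^-1` B i)) =
    (\prod_(i in J) P (X i @^-1` B i))%E.

Definition iid_RVs (I : finType) d' (E : measurableType d')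
    (X : I -> {RV P >-> E}) : Prop :=
  independent_RVs X /\
  forall i k B, measurable B -> distribution P (X i) B = distribution P (X k) B.

End probability_notions.

Definition Gamma (R : realType) (a : R) : R :=
  \int[lebesgue_measure]_(t in `]0, +oo[%classic) (t `^ (a - 1) * expR (- t)).

Definition gamma_density (R : realType) (a t : R) : R :=
  if 0 < t then (Gamma a)^-1 * t `^ (a - 1) * expR (- t) else 0.

Definition gamma_law (R : realType) (a : R) (mu : set R -> \bar R) : Prop :=
  forall B : set R, measurable B ->
    mu B = (\int[lebesgue_measure]_(t in B) (gamma_density a t)%:E)%E.

(* mu is the Dirichlet distribution: the law of the normalization of some
   independent Gamma variables (the law does not depend on their choice). *)
Definition dirichlet_law (R : realType) (n : nat) (a : 'I_n -> {posnum R})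
    (mu : set (borel_mx R 1 n) -> \bar R) : Prop :=
  exists d (T : measurableType d) (P : probability T R)
      (G : 'I_n -> {RV P >-> R}),
    [/\ independent_RVs G,
        forall i, gamma_law (a i)%:num (distribution P (G i)) &
        forall B : set (borel_mx R 1 n), measurable B ->
          mu B = P [set w | B (\row_i (G i w / \sum_k G k w))]].

(* Main.v *)
(* The corners {x | x_ij >= t_ij for all i, j} form a pi-system generating the
   Borel sets of matrices, so a finite measure is determined by its values on
   them.

   In the affine chart forgetting one column, the n(n-1)-dimensional Hausdorff
   measure is translation invariant, finite on boxes, and additive on sets
   separated by a slab; hence it is a measure on the Borel sets, proportional to
   the volume on boxes (Cauchy's functional equation in each coordinate), and
   scaled by prod s_ij under x_ij |-> s_ij x_ij. It is not zero by the mass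
   distribution principle applied to independent uniform coordinates. As the
   trace of a corner on the Markov matrices is a product of simplices, the i-th
   one being homothetic to the standard simplex with ratio 1 - sum_j t_ij, the
   uniform distribution gives it the mass prod_i (1 - sum_j t_ij)^(n-1): it is the
   product of n copies of a law D on the simplex with
   D(x_j >= t_j for all j) = (1 - sum_j t_j)^(n-1).

   If x has law D and s is independent of x with density s^(n-1) e^(-s) up to a
   constant, then integrating (1 - a/s)^(n-1) shows that s x falls into the corner
   of t with probability e^(-a), a = sum_j t_j. So s x has independent exponential
   coordinates, and D, the law of their normalization, is D_n(1, .., 1). *)

Require Import Defs.
From HB Require Import structures.
From mathcomp Require Import all_boot all_order all_algebra perm.
From mathcomp Require Import all_classical all_reals all_analysis.
From mathcomp Require Import measurable_realfun ring lra.

Set Implicit Arguments.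
Unset Strict Implicit.
Unset Printing Implicit Defensive.

Import Order.TTheory GRing.Theory Num.Theory numFieldNormedType.Exports.

Local Open Scope classical_set_scope.
Local Open Scope ring_scope.

(** * Corners, boxes and the Borel sets of matrices *)

Section matrix_measurability.
Context (R : realType) (m n : nat).

Lemma measurable_coord (i : 'I_m) (j : 'I_n) :
  measurable_fun setT (fun A : borel_mx R m n => (A : 'M[R]_(m, n)) i j).
Proof.
apply: (measurability _ (RGenOpens.measurableE R)) => _ [_ [a [b ->]] <-].
rewrite setTI; apply: sub_gen_smallest.
by move/continuousP: (@coord_continuous R m n i j); apply; exact: interval_open.
Qed.

(** Second countability: sup-norm balls with rational centres and radii 1/(k+1) form a countable
    base, which turns openness into countably many conditions on entries. *)
Lemma open_rat_bigcup (U : set 'M[R]_(m, n)) : open U ->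
  U = \bigcup_(ak in [set ak : 'M[rat]_(m, n) * nat |
        [set x : 'M[R]_(m, n) | forall i j, `|ratr (ak.1 i j) - x i j| < ak.2.+1%:R^-1]
          `<=` U])
      [set x | forall i j, `|ratr (ak.1 i j) - x i j| < ak.2.+1%:R^-1].
Proof.
move=> oU; apply/seteqP; split=> [x Ux|x [ak /= akU] /akU//].
have : nbhs x U by exact: open_nbhs_nbhs.
move=> /nbhs_ballP[e /= e0 xeU].
(* The radius stays below e/2 since two such radii separate [x] from the other points of the
   ball. *)
have [k _ ke] : exists2 k : nat, True & k.+1%:R^-1 < e / 2.
  have [k _ /(_ k (leqnn k)) ke] := near_infty_natSinv_lt (PosNum (divr_gt0 e0 (ltr0n _ 2))).
  by exists k.
have /choice[f Hf] : forall ij : 'I_m * 'I_n, exists q : rat,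
    `|ratr q - x ij.1 ij.2| < k.+1%:R^-1.
  move=> ij.
  have : x ij.1 ij.2 - k.+1%:R^-1 < x ij.1 ij.2 + k.+1%:R^-1.
    by rewrite ltrD2l gt0_cp// invr_gt0.
  move=> /rat_in_itvoo[q]; rewrite in_itv/= => /andP[h1 h2]; exists q.
  by rewrite ltr_distl h1 h2.
exists (\matrix_(i, j) f (i, j), k) => /=; last by move=> i j; rewrite mxE (Hf (i, j)).
move=> y Hy; apply: xeU; split=> // i j.
have := Hy i j; have := Hf (i, j); rewrite mxE /= distrC => h1 h2.
rewrite -ball_normE /ball_/= (le_lt_trans (ler_distD (ratr (f (i, j))) _ _))//.
by rewrite (splitr e) ltrD// (lt_trans _ ke).
Qed.

(** By the base above, the preimage of an open set is a countable union of finite intersections of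
    conditions on single entries. *)
Lemma measurable_mx d (T : measurableType d) (f : T -> borel_mx R m n) :
  (forall i j, measurable_fun setT (fun w => (f w : 'M[R]_(m, n)) i j)) ->
  measurable_fun setT f.
Proof.
move=> mf; apply: (@measurability _ _ T (borel_mx R m n) setT f
  (@open 'M[R]_(m, n))) => //.
move=> _ [U oU <-]; rewrite setTI (open_rat_bigcup oU) preimage_bigcup.
rewrite bigcup_mkcond; apply: countable_bigcupT_measurable.
  exact: countableP.
move=> ak; case: ifPn => // _.
rewrite [X in measurable X](_ : _ = \bigcap_(ij in [set: 'I_m * 'I_n])
    ((fun w => (f w : 'M[R]_(m, n)) ij.1 ij.2) @^-1`
      `]ratr (ak.1 ij.1 ij.2) - ak.2.+1%:R^-1,
        ratr (ak.1 ij.1 ij.2) + ak.2.+1%:R^-1[%classic)).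
  apply: fin_bigcap_measurable => // ij _.
  by rewrite -[X in measurable X]setTI; exact: mf.
apply/seteqP; split=> w /= Hw.
  by move=> -[i j] _ /=; have := Hw i j; rewrite in_itv/= distrC ltr_distl.
move=> i j; have := Hw (i, j) Logic.I; rewrite /= in_itv/= distrC ltr_distl.
by [].
Qed.

Lemma coord_lt_truncn (x : 'M[R]_(m, n)) i j :
  `|x i j| < (Num.truncn `|x|).+1%:R.
Proof.
rewrite (le_lt_trans _ (truncnS_gt _))//.
by rewrite [leRHS]/Num.norm/= mx_normrE; exact: le_trans (le_bigmax _ _ (i, j)).
Qed.

Definition corner (t : 'M[R]_(m, n)) : set 'M[R]_(m, n) :=
  [set x | forall i j, t i j <= x i j].

Definition corners : set (set 'M[R]_(m, n)) := range corner.

Definition box (a b : 'M[R]_(m, n)) : set 'M[R]_(m, n) :=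
  [set x | forall i j, a i j <= x i j < b i j].

Definition boxes : set (set 'M[R]_(m, n)) :=
  [set B | exists a b, B = box a b].

Lemma measurable_halfspace (i : 'I_m) (j : 'I_n) (c : R) :
  measurable ([set x : 'M[R]_(m, n) | c <= x i j] : set (borel_mx R m n)).
Proof.
rewrite [X in measurable X](_ : _ = setT `&`
   (fun A : borel_mx R m n => (A : 'M[R]_(m, n)) i j) @^-1` `[c, +oo[%classic).
  exact: measurable_coord.
by apply/seteqP; split=> x/=; rewrite in_itv/= andbT => // -[].
Qed.

(** [measurable_mx] is applied to the identity out of the sigma-algebra generated by [G], whose
    entries are measurable once the half-spaces lie in it. *)
Lemma borel_mx_sub (G : set (set 'M[R]_(m, n))) :
  (forall i j c, <<s G >> [set x : 'M[R]_(m, n) | c <= x i j]) ->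
  (@measurable _ (borel_mx R m n) : set (set 'M[R]_(m, n))) `<=` <<s G >>.
Proof.
move=> hG A mA.
have := @measurable_mx _ (g_sigma_algebraType G) id.
rewrite -[A]setTI => /(_ _ measurableT A mA); apply => i j.
apply: (measurability _ (RGenCInfty.measurableE R)).
move=> _ [_ [c ->] <-]; rewrite setTI.
rewrite [X in measurable X](_ : _ = [set x : g_sigma_algebraType G |
  c <= (x : 'M[R]_(m, n)) i j]); first exact: hG.
by apply/seteqP; split=> x/=; rewrite in_itv/= andbT.
Qed.

Lemma measurable_entrywise (S : set 'M[R]_(m, n)) (P : 'I_m -> 'I_n -> set R) :
  (forall i j, measurable (P i j)) ->
  S = [set x | forall i j, P i j (x i j)] -> measurable (S : set (borel_mx R m n)).
Proof.
move=> mP ->; rewrite [X in measurable X](_ : _ = \bigcap_(ij in [set: 'I_m * 'I_n])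
    ((fun w : borel_mx R m n => (w : 'M[R]_(m, n)) ij.1 ij.2) @^-1` P ij.1 ij.2)).
  apply: fin_bigcap_measurable => // ij _.
  by rewrite -[X in measurable X]setTI; exact: measurable_coord.
apply/seteqP; split=> w /= Hw; first by move=> -[i j] _; exact: Hw.
by move=> i j; exact: (Hw (i, j) Logic.I).
Qed.

Lemma measurable_corner t : measurable (corner t : set (borel_mx R m n)).
Proof.
apply: (@measurable_entrywise _ (fun i j => `[t i j, +oo[%classic)) => //.
by apply/seteqP; split=> x /= H i j; have := H i j; rewrite /= in_itv/= andbT.
Qed.

Lemma measurable_box a b : measurable (box a b : set (borel_mx R m n)).
Proof.
apply: (@measurable_entrywise _ (fun i j => `[a i j, b i j[%classic)) => //.
Qed.

Lemma borel_mx_corners :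
  (@measurable _ (borel_mx R m n) : set (set 'M[R]_(m, n))) = <<s corners >>.
Proof.
apply/seteqP; split; last first.
  apply: smallest_sub; first exact: sigma_algebra_measurable.
  by move=> _ [t _ <-]; exact: measurable_corner.
apply: borel_mx_sub => i j c.
(* A half-space is an increasing union of corners whose other entries are bounded below by -k. *)
have -> : [set x : 'M[R]_(m, n) | c <= x i j] = \bigcup_(k : nat)
  corner (\matrix_(i', j') if (i' == i) && (j' == j) then c else - k%:R); last first.
  apply: (@bigcupT_measurable _ (g_sigma_algebraType corners)) => k.
  by apply: sub_sigma_algebra; exists
   (\matrix_(i', j') if (i' == i) && (j' == j) then c else - k%:R).
apply/seteqP; split=> x /=; last first.
  by move=> [k _ /(_ i j)]; rewrite mxE !eqxx.
move=> cx; exists (Num.truncn (`|x|)).+1 => // i' j'; rewrite mxE.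
case: ifPn => [/andP[/eqP-> /eqP->]//|_].
by have := coord_lt_truncn x i' j'; rewrite ltr_norml => /andP[/ltW].
Qed.

Lemma borel_mx_boxes :
  (@measurable _ (borel_mx R m n) : set (set 'M[R]_(m, n))) = <<s boxes >>.
Proof.
apply/seteqP; split; last first.
  apply: smallest_sub; first exact: sigma_algebra_measurable.
  by move=> _ [a [b ->]]; exact: measurable_box.
apply: borel_mx_sub => i j c.
have -> : [set x : 'M[R]_(m, n) | c <= x i j] = \bigcup_(k : nat)
  box (\matrix_(i', j') if (i' == i) && (j' == j) then c else - k%:R)
   (const_mx k%:R); last first.
  apply: (@bigcupT_measurable _ (g_sigma_algebraType boxes)) => k.
  by apply: sub_sigma_algebra; do 2!eexists; reflexivity.
apply/seteqP; split=> x /=; last first.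
  by move=> [k _ /(_ i j)]; rewrite !mxE !eqxx => /andP[].
move=> cx; exists (Num.truncn (`|x|)).+1 => // i' j'; rewrite !mxE.
have := coord_lt_truncn x i' j'; rewrite ltr_norml => /andP[h1 ->]; rewrite andbT.
by case: ifPn => [/andP[/eqP-> /eqP->]//|_]; exact: ltW.
Qed.

Lemma setI_closed_corners : setI_closed corners.
Proof.
move=> _ _ [s _ <-] [t _ <-]; exists (\matrix_(i, j) Num.max (s i j) (t i j)) => //.
apply/seteqP; split=> x /=.
  by move=> H; split=> i j; have := H i j; rewrite mxE ge_max => /andP[].
by move=> [Hs Ht] i j; rewrite mxE ge_max Hs Ht.
Qed.

Lemma setI_closed_boxes : setI_closed boxes.
Proof.
move=> _ _ [a [b ->]] [c [d ->]].
exists (\matrix_(i, j) Num.max (a i j) (c i j)).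
exists (\matrix_(i, j) Num.min (b i j) (d i j)).
apply/seteqP; split=> x /=.
  move=> [H1 H2] i j; rewrite !mxE ge_max lt_min.
  by have /andP[-> ->] := H1 i j; have /andP[-> ->] := H2 i j.
by move=> H; split=> i j; have := H i j; rewrite !mxE ge_max lt_min;
   move=> /andP[/andP[h1 h2] /andP[h3 h4]]; rewrite ?h1 ?h2 ?h3 ?h4.
Qed.

Lemma corner_unique (mu nu : {measure set (borel_mx R m n) -> \bar R}) :
  (mu setT < +oo)%E -> (forall t, mu (corner t) = nu (corner t)) ->
  forall A : set (borel_mx R m n), measurable A -> mu A = nu A.
Proof.
move=> muoo munu A mA.
apply: (@measure_unique _ R (borel_mx R m n) corners (fun k => corner (const_mx (- k%:R)))) => //.
- exact: borel_mx_corners.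
- exact: setI_closed_corners.
- by move=> k; exists (const_mx (- k%:R)).
- apply/seteqP; split=> // x _; exists (Num.truncn (`|x|)).+1 => // i j.
  by have := coord_lt_truncn x i j; rewrite mxE ltr_norml => /andP[/ltW].
- by move=> _ [t _ <-]; exact: munu.
- move=> k; apply: le_lt_trans muoo; apply: le_measure; rewrite ?inE//.
  exact: measurable_corner.
Qed.

(** Boxes replace corners for measures that are finite on bounded sets but possibly infinite in
    total, such as the chart measure below. *)
Lemma box_unique (mu nu : {measure set (borel_mx R m n) -> \bar R}) :
  (forall a b, (mu (box a b) < +oo)%E) ->
  (forall a b, mu (box a b) = nu (box a b)) ->
  forall A : set (borel_mx R m n), measurable A -> mu A = nu A.
Proof.
move=> muoo munu A mA.
apply: (@measure_unique _ R (borel_mx R m n) boxes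
  (fun k => box (const_mx (- k%:R)) (const_mx k%:R))) => //.
- exact: borel_mx_boxes.
- exact: setI_closed_boxes.
- by move=> k; do 2!eexists; reflexivity.
- apply/seteqP; split=> // x _; exists (Num.truncn (`|x|)).+1 => // i j.
  by have := coord_lt_truncn x i j; rewrite !mxE ltr_norml => /andP[/ltW-> ->].
- by move=> _ [a [b ->]]; exact: munu.
Qed.

End matrix_measurability.

(** * Hausdorff outer measures *)

Section hausdorff_outer_measure.
Context (R : realType) (m n d : nat).
Implicit Types (A B F : set 'M[R]_(m, n)) (x y : 'M[R]_(m, n)).
Local Open Scope ereal_scope.

Lemma eucl_distxx x : eucl_dist x x = 0%R.
Proof.
rewrite /eucl_dist big1 ?sqrtr0// => i _; rewrite big1// => j _.
by rewrite subrr expr0n.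
Qed.

Lemma eucl_dist_le_diameter F x y : F x -> F y -> (eucl_dist x y)%:E <= diameter F.
Proof. by move=> Fx Fy; apply: ereal_sup_ubound; exists (x, y). Qed.

Lemma diameter_set0 : diameter (set0 : set 'M[R]_(m, n)) = -oo.
Proof. by rewrite /diameter setX0 image_set0 ereal_sup0. Qed.

Lemma diam_pow_ge0 F : 0 <= diam_pow d F.
Proof.
rewrite /diam_pow; case: ifPn => // /set0P[x Fx]; apply: expe_ge0.
by rewrite -[0]/(0%R%:E) -(eucl_distxx x) eucl_dist_le_diameter.
Qed.

Lemma diam_pow_set0 : diam_pow d (set0 : set 'M[R]_(m, n)) = 0.
Proof. by rewrite /diam_pow eqxx. Qed.

(* Turning the mesh condition into an infinite cost makes [hausdorff_pre] an
   instance of the library's construction of outer measures from set functions. *)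
Let cost (delta : R) F : \bar R :=
  if diameter F <= delta%:E then diam_pow d F else +oo.

Let cost_ge0 delta F : 0 <= cost delta F.
Proof. by rewrite /cost; case: ifP => // _; exact: diam_pow_ge0. Qed.

Let cost0 delta : cost delta set0 = 0.
Proof. by rewrite /cost diameter_set0 leNye diam_pow_set0. Qed.

(** [mu_ext] ranges over covers by measurable sets; declaring every set measurable allows the
    arbitrary covers of [hausdorff_pre]. *)
Let T := g_sigma_algebraType [set: set 'M[R]_(m, n)].

Let hausdorff_preE delta : hausdorff_pre d delta = mu_ext (cost delta : set T -> _).
Proof.
apply/funext => A; apply/eqP; rewrite eq_le; apply/andP; split.
  apply: le_ereal_inf_tmp => _ [F [_ AF] <-].
  have [hF|/existsNP[k /negP hF]] := pselect (forall k, diameter (F k) <= delta%:E).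
    by apply: ereal_inf_lbound; exists F => //; apply: eq_eseriesr => k _; rewrite /cost hF.
  by rewrite (@eseries_pinfty _ _ xpredT k) ?leey//= /cost ?(negbTE hF)// => i _;
    rewrite -ltNye (lt_le_trans _ (cost_ge0 delta (F i))).
apply: le_ereal_inf_tmp => _ [F [AF hF] <-].
apply: ereal_inf_lbound; exists F; last by apply: eq_eseriesr => k _; rewrite /cost hF.
by split=> // k; exact: sub_sigma_algebra.
Qed.

Lemma hausdorff_pre_ge0 delta A : 0 <= hausdorff_pre d delta A.
Proof. by rewrite hausdorff_preE; exact: (@mu_ext_ge0 _ T R). Qed.

Lemma le_hausdorff_pre delta : {homo (@hausdorff_pre R m n d delta) : A B / A `<=` B >-> A <= B}.
Proof. by rewrite hausdorff_preE; exact: (@le_mu_ext _ T R). Qed.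

Lemma hausdorff_pre_set0 delta : hausdorff_pre d delta (set0 : set 'M[R]_(m, n)) = 0.
Proof. by rewrite hausdorff_preE (@mu_ext0 _ T R). Qed.

Lemma hausdorff_pre_sigma_subadditive delta :
  sigma_subadditive (@hausdorff_pre R m n d delta).
Proof. by rewrite hausdorff_preE; exact: (@mu_ext_sigma_subadditive _ T R). Qed.

HB.instance Definition _ delta := isOuterMeasure.Build R 'M[R]_(m, n)
  (@hausdorff_pre R m n d delta) (hausdorff_pre_set0 delta) (hausdorff_pre_ge0 delta)
  (le_hausdorff_pre delta) (hausdorff_pre_sigma_subadditive delta).

Lemma hausdorff_pre_mesh (delta delta' : R) A : (delta <= delta')%R ->
  hausdorff_pre d delta' A <= hausdorff_pre d delta A.
Proof.
move=> dd; apply: ereal_inf_le_tmp => _ [F [AF hF] <-]; exists F => //; split=> // k.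
by rewrite (le_trans (hF k))// lee_fin.
Qed.

Lemma hausdorff_pre_le (delta : R) A : (0 < delta)%R -> hausdorff_pre d delta A <= hausdorff d A.
Proof. by move=> d0; apply: ereal_sup_ubound; exists delta. Qed.

Lemma hausdorff_ge0 A : 0 <= hausdorff d A.
Proof. exact: le_trans (hausdorff_pre_ge0 1 A) (hausdorff_pre_le _ ltr01). Qed.

Lemma hausdorff_set0 : hausdorff d (set0 : set 'M[R]_(m, n)) = 0.
Proof.
apply/eqP; rewrite eq_le hausdorff_ge0 andbT; apply: ge_ereal_sup => _ [delta d0 <-].
by rewrite hausdorff_pre_set0.
Qed.

Lemma le_hausdorff : {homo (@hausdorff R m n d) : A B / A `<=` B >-> A <= B}.
Proof.
move=> A B AB; apply: ge_ereal_sup => _ [delta d0 <-].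
exact: le_trans (le_hausdorff_pre delta AB) (hausdorff_pre_le _ d0).
Qed.

Lemma hausdorff_sigma_subadditive : sigma_subadditive (@hausdorff R m n d).
Proof.
move=> F; apply: ge_ereal_sup => _ [delta d0 <-].
apply: (@le_trans _ _ (\sum_(i <oo) hausdorff_pre d delta (F i))).
  exact: hausdorff_pre_sigma_subadditive.
by apply: lee_nneseries => // [k _ _|k _]; [exact: hausdorff_pre_ge0|exact: hausdorff_pre_le].
Qed.

HB.instance Definition _ := isOuterMeasure.Build R 'M[R]_(m, n) (@hausdorff R m n d)
  hausdorff_set0 hausdorff_ge0 le_hausdorff hausdorff_sigma_subadditive.

Lemma diam_pow_le F (r : R) : (0 <= r)%R -> diameter F <= r%:E ->
  diam_pow d F <= (r ^+ d)%R%:E.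
Proof.
move=> r0 Fr; rewrite /diam_pow; case: ifPn => [_|/set0P[x Fx]].
  by rewrite lee_fin exprn_ge0.
have F0 : 0 <= diameter F.
  by rewrite -[0]/(0%R%:E) -(eucl_distxx x) eucl_dist_le_diameter.
have Ffin : diameter F \is a fin_num by rewrite ge0_fin_numE// (le_lt_trans Fr)// ltry.
rewrite -(fineK Ffin) -EFin_expe lee_fin lerXn2r// ?nnegrE ?fine_ge0//.
by rewrite -lee_fin fineK.
Qed.

Lemma hausdorff_pre_le_diam_pow (delta : R) F : diameter F <= delta%:E ->
  hausdorff_pre d delta F <= diam_pow d F.
Proof.
move=> Fd; apply: ereal_inf_lbound; exists (fun k => if k is 0%N then F else set0).
  by split=> [x Fx|[|k]//=]; [exists 0%N|rewrite diameter_set0 leNye].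
rewrite nneseries_recl// => [|k _]; last exact: diam_pow_ge0.
by rewrite eseries_cond eseries0 ?adde0// => -[|i]// _ _; rewrite diam_pow_set0.
Qed.

(** Subadditivity along the enumeration of [I]. This is the form suited to the grid covers of
    boxes. *)
Lemma hausdorff_pre_cover (delta r : R) (I : finType) (S : I -> set 'M[R]_(m, n)) A :
  (0 <= r)%R -> (r <= delta)%R -> (forall i, diameter (S i) <= r%:E) ->
  (A `<=` \bigcup_i S i) -> hausdorff_pre d delta A <= (#|I|%:R * r ^+ d)%R%:E.
Proof.
move=> r0 rd Sr AS.
have main (s : seq I) : hausdorff_pre d delta (\bigcup_(i in [set` s]) S i) <=
    ((size s)%:R * r ^+ d)%R%:E.
  elim: s => [|i s IHs].
    by rewrite bigcup0 ?mul0r ?outer_measure0// => i; rewrite /= in_nil.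
  have -> : \bigcup_(j in [set` i :: s]) S j = S i `|` \bigcup_(j in [set` s]) S j.
    apply/seteqP; split=> [x [j /=]|x [Six|[j js Sjx]]].
    - by rewrite inE => /predU1P[->|js] Sjx; [left|right; exists j].
    - by exists i => //=; rewrite mem_head.
    - by exists j => //=; rewrite in_cons js orbT.
  apply: le_trans (outer_measureU2 _ _ _) _.
  rewrite /= -nat1r mulrDl mul1r EFinD leeD//.
  apply: le_trans (hausdorff_pre_le_diam_pow _) (diam_pow_le r0 _) => //.
  by rewrite (le_trans (Sr i))// lee_fin.
rewrite cardE; apply: le_trans (main _); apply: le_hausdorff_pre => x /AS[i _ Six].
by exists i => //=; rewrite mem_enum.
Qed.

(** An isometry carries a cover to a cover of the image by pieces of the same diameters, hence of
    the same cost. *)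
Lemma hausdorff_image_le (f : 'M[R]_(m, n) -> 'M[R]_(m, n)) A :
  (forall x y, eucl_dist (f x) (f y) = eucl_dist x y) ->
  hausdorff d (f @` A) <= hausdorff d A.
Proof.
move=> fiso.
have diamf F : diameter (f @` F) = diameter F.
  congr ereal_sup; apply/seteqP; split=> _ [[x y] [/= Fx Fy] <-].
    by case: Fx Fy => u Fu <- [v Fv <-]; exists (u, v) => //; rewrite fiso.
  by exists (f x, f y); [split; [exists x|exists y]|rewrite /= fiso].
have diam_powf F : diam_pow d (f @` F) = diam_pow d F.
  rewrite /diam_pow diamf; have [->|F0] := eqVneq F set0; first by rewrite image_set0 eqxx.
  case: eqP => // /image_set0_set0 F0'.
  by rewrite F0' eqxx in F0.
apply: ge_ereal_sup => _ [delta d0 <-]; apply: le_trans (hausdorff_pre_le _ d0).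
apply: le_ereal_inf_tmp => _ [F [AF hF] <-].
apply: ereal_inf_lbound; exists (fun k => f @` F k).
  split=> [_ [x /AF[k _ Fkx] <-]|k]; last by rewrite diamf.
  by exists k => //; exists x.
by apply: eq_eseriesr => k _.
Qed.

Lemma hausdorff_isometry (f g : 'M[R]_(m, n) -> 'M[R]_(m, n)) A :
  (forall x y, eucl_dist (f x) (f y) = eucl_dist x y) -> cancel f g -> cancel g f ->
  hausdorff d (f @` A) = hausdorff d A.
Proof.
move=> fiso fg gf; apply/eqP; rewrite eq_le hausdorff_image_le//=.
have giso x y : eucl_dist (g x) (g y) = eucl_dist x y by rewrite -fiso !gf.
apply: le_trans (hausdorff_image_le (f @` A) giso).
by apply: le_hausdorff => x Ax; exists (f x) => //; exists x.
Qed.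

(** A piece of diameter less than [e] cannot meet both sets, so a fine cover of the union splits
    into a cover of [A] and a cover of [B]. *)
Lemma hausdorff_separated (e : R) A B : (0 < e)%R ->
  (forall x y, A x -> B y -> (e <= eucl_dist x y)%R) ->
  hausdorff d A + hausdorff d B <= hausdorff d (A `|` B).
Proof.
move=> e0 sepAB.
have step (delta : R) : (delta < e)%R ->
    hausdorff_pre d delta A + hausdorff_pre d delta B <= hausdorff_pre d delta (A `|` B).
  move=> de; apply: le_ereal_inf_tmp => _ [F [ABF hF] <-].
  pose FA k := if `[< F k `&` A !=set0 >] then F k else set0.
  pose FB k := if `[< F k `&` A !=set0 >] then set0 else F k.
  have -> : \sum_(0 <= k <oo) diam_pow d (F k) =
      \sum_(0 <= k <oo) diam_pow d (FA k) + \sum_(0 <= k <oo) diam_pow d (FB k).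
    rewrite -nneseriesD => [|k _ _|k _ _]; [|exact: diam_pow_ge0..].
    apply: eq_eseriesr => k _; rewrite /FA /FB.
    by case: ifP => _; rewrite diam_pow_set0 (add0e, adde0).
  apply: leeD; apply: ereal_inf_lbound; [exists FA|exists FB] => //; split.
  - move=> x Ax; have [k _ Fkx] := ABF x (or_introl Ax); exists k => //.
    by rewrite /FA ifT//; apply/asboolP; exists x.
  - by move=> k; rewrite /FA; case: ifP => // _; rewrite diameter_set0 leNye.
  - move=> y By; have [k _ Fky] := ABF y (or_intror By); exists k => //.
    rewrite /FB ifF//; apply/negP => /asboolP[x [Fkx Ax]].
    have := le_trans (eucl_dist_le_diameter Fkx Fky) (hF k).
    by rewrite lee_fin => /(le_trans (sepAB _ _ Ax By)); rewrite leNgt de.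
  - by move=> k; rewrite /FB; case: ifP => // _; rewrite diameter_set0 leNye.
(* Two unrelated meshes let the suprema defining the two terms be taken one after the other. *)
have step2 (delta delta' : R) : (0 < delta)%R -> (0 < delta')%R ->
    hausdorff_pre d delta A + hausdorff_pre d delta' B <= hausdorff d (A `|` B).
  move=> d0 d0'; pose r : R := Num.min (Num.min (delta : R) (delta' : R)) (e / 2)%R.
  have r0 : (0 < r)%R by rewrite !lt_min d0 d0' divr_gt0.
  apply: le_trans (hausdorff_pre_le _ r0).
  apply: le_trans (step r _); last first.
    by rewrite gt_min; apply/orP; right; rewrite ltr_pdivrMr// ltr_pMr// ltr1n.
  by apply: leeD; apply: hausdorff_pre_mesh; rewrite !ge_min lexx ?orbT.
have [->|Noo] := eqVneq (hausdorff d (A `|` B)) +oo; first by rewrite leey.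
(* Finiteness allows moving one term across the inequality before taking the supremum in the
   other. *)
have fin (delta : R) : (0 < delta)%R -> hausdorff_pre d delta B \is a fin_num.
  move=> d0; rewrite ge0_fin_numE ?hausdorff_pre_ge0//.
  rewrite (@le_lt_trans _ _ (hausdorff d (A `|` B))) ?ltey//.
  by apply: le_trans (step2 _ _ d0 d0); rewrite leeDr// hausdorff_pre_ge0.
have finA : hausdorff d A \is a fin_num.
  rewrite ge0_fin_numE ?hausdorff_ge0//.
  rewrite (@le_lt_trans _ _ (hausdorff d (A `|` B))) ?ltey//.
  exact/le_hausdorff/subsetUl.
rewrite addeC -leeBrDr//; apply: ge_ereal_sup => _ [delta' d0' <-].
rewrite leeBrDr// addeC -leeBrDr ?fin//; apply: ge_ereal_sup => _ [delta d0 <-].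
by rewrite leeBrDr ?fin// step2.
Qed.

End hausdorff_outer_measure.

(** * Translation-invariant outer measures *)

Section separated_caratheodory.
Context (R : realType) (T : Type) (mu : {outer_measure set T -> \bar R}) (f : T -> R).
Local Open Scope ereal_scope.

Hypothesis mu_sep : forall (c c' : R) A B, (c < c')%R ->
  (forall x, A x -> (f x <= c)%R) -> (forall x, B x -> (c' <= f x)%R) ->
  mu A + mu B <= mu (A `|` B).

(* Caratheodory's criterion for metric outer measures: the sets [layer k] of
   [X] that accumulate at the level [c] have a convergent total mass because
   layers of the same parity are separated. *)
Lemma separated_caratheodory (c : R) : mu.-caratheodory [set x | (c <= f x)%R].
Proof.
apply: le_caratheodory_measurable => X.
have [->|Xoo] := eqVneq (mu X) +oo; first by rewrite leey.
have Xfin : mu X \is a fin_num by rewrite ge0_fin_numE ?outer_measure_ge0 ?ltey.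
(* The levels [s k] increase to [c]; consecutive levels delimit the layers. *)
pose s k : R := (c - k.+1%:R^-1)%R.
have s_lt j k : (j < k)%N -> (s j < s k)%R.
  by move=> jk; rewrite ltrD2l ltrN2 ltf_pV2 ?posrE// ltr_nat ltnS.
have s_le j k : (j <= k)%N -> (s j <= s k)%R.
  by rewrite leq_eqVlt => /orP[/eqP->//|/s_lt/ltW].
pose L (k : nat) := X `&` [set x | (f x <= s k)%R].
pose layer (k : nat) := X `&` [set x | (s k < f x <= s k.+1)%R].
(* Adjacent layers touch at a level, but between two consecutive layers of the same parity lies a
   whole layer as a gap. *)
have parity b N : \sum_(i < N.+1) mu (layer (b + i.*2)%N) <= mu (L (b + N.*2).+1).
  elim: N => [|N IHN].
    rewrite big_ord1 /=; apply: le_outer_measure => x [Xx /andP[_ fx]].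
    by split.
  rewrite big_ord_recr/=; apply: le_trans (leeD2r _ IHN) _.
  apply: le_trans (mu_sep (s_lt (b + N.*2).+1 (b + N.+1.*2)%N _) _ _) _.
  - by rewrite doubleS addnS ltnS addnS.
  - by move=> x [].
  - by move=> x [_ /andP[/ltW]].
  - apply: le_outer_measure => x [[Xx fx]|[Xx /andP[_ fx]]]; split => //.
    by apply: le_trans fx (s_le _ _ _); rewrite ltnS leq_add2l leq_double.
have LX k : mu (L k) <= mu X by apply: le_outer_measure => x [].
have layers2 N : \sum_(i < N.*2) mu (layer i) <= mu X + mu X.
  have -> : \sum_(i < N.*2) mu (layer i) =
      \sum_(i < N) mu (layer (0 + i.*2)%N) + \sum_(i < N) mu (layer (1 + i.*2)%N).
    elim: N => [|N IHN]; first by rewrite !big_ord0 adde0.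
    by rewrite doubleS !big_ord_recr/= IHN add0n add1n -!addeA; congr (_ + _);
      rewrite addeCA.
  case: N => [|N]; first by rewrite !big_ord0 !adde0 adde_ge0// outer_measure_ge0.
  by apply: leeD; apply: le_trans (parity _ _) (LX _).
have layers_fin : \sum_(0 <= i <oo) mu (layer i) < +oo.
  apply: (@le_lt_trans _ _ (mu X + mu X)); last by rewrite lte_add_pinfty// ltey.
  apply: lime_le; first by apply: is_cvg_nneseries => *; exact: outer_measure_ge0.
  apply: nearW => N; rewrite big_mkord; apply: le_trans (layers2 N).
  rewrite -!(big_mkord xpredT (fun i => mu (layer i))).
  rewrite -addnn [leRHS](big_cat_nat _ (n := N))//= ?leq_addr// leeDl//.
  by apply: sume_ge0 => *; exact: outer_measure_ge0.
have /(_ (fun _ _ => outer_measure_ge0 mu _)) tail0 := nneseries_tail_cvg layers_fin.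
(* The inequality is proved up to the mass of the layers from [k] on, which tends to 0. *)
have cv : (fun k => mu X + \sum_(k <= i <oo) mu (layer i)) @ \oo --> mu X + 0.
  by apply: cvgeD => //; [rewrite fin_num_adde_defr|exact: cvg_cst].
rewrite -[leRHS]adde0 -(cvg_lim _ cv)//; apply: lime_ge; first exact: (cvgP _ cv).
apply: nearW => k.
have Xbelow : X `&` ~` [set x | (c <= f x)%R] `<=`
    L k `|` \bigcup_(i in ~` `I_k) layer i.
  move=> x [Xx /negP]; rewrite -ltNge => fxc.
  have [fxk|kfx] := leP (f x) (s k); first by left.
  right; have [j fxj] : exists j, (f x <= s j)%R.
    have cfx : (0 < c - f x)%R by rewrite subr_gt0.
    have [j _ /(_ j (leqnn j))/ltW/= jc] := near_infty_natSinv_lt (PosNum cfx).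
    by exists j; rewrite /s lerBrDr -lerBrDl.
  (* The least such [j] exceeds [k] because the levels increase, so [x] lies in a layer of index at
     least [k]. *)
  case: (ex_minnP (ex_intro (fun j => f x <= s j)%R j fxj)) => {fxj}j fxj jmin.
  case: j fxj jmin => [|j] fxj jmin.
    by have := lt_le_trans kfx fxj; rewrite ltNge s_le.
  exists j.
    move=> /= jk; have := lt_le_trans kfx fxj; rewrite ltNge s_le//.
  split=> //=; rewrite fxj andbT ltNge; apply/negP => /jmin.
  by rewrite ltnn.
rewrite addeC; apply: (@le_trans _ _
    (mu (L k) + \sum_(k <= i <oo) mu (layer i) + mu (X `&` [set x | (c <= f x)%R]))).
  rewrite leeD2r//; apply: le_trans (le_outer_measure mu _ _ Xbelow) _.
  by apply: le_trans (outer_measureU2 _ _ _) _;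
    rewrite leeD2l// outer_measure_sigma_subadditive_tail.
rewrite addeAC leeD2r//; apply: le_trans (mu_sep (c := s k) (c' := c) _ _ _) _.
- by rewrite /s ltrBlDr ltrDl invr_gt0.
- by move=> x [].
- by move=> x [].
- by apply: le_outer_measure => x [[]|[]].
Qed.

End separated_caratheodory.

Lemma pushforward_measure_ex d d' (T1 : measurableType d) (T2 : measurableType d')
    (R : realType) (m : {measure set T1 -> \bar R}) (f : T1 -> T2) :
  measurable_fun setT f ->
  exists mu : {measure set T2 -> \bar R}, forall A, mu A = m (f @^-1` A).
Proof.
move=> mf.
by exists (measure_function_pushforward__canonical__measure_function_Measure m mf).
Qed.

(** Cauchy's functional equation. Nonnegativity makes [g] monotone; placing [s] between consecutive
    multiples of 1/(N+1) confines both [g s] and [s * g 1] to one interval of length g(1/(N+1)). *)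
Lemma additive_linear (R : realType) (g : R -> R) :
  (forall s, 0 <= s -> 0 <= g s) ->
  (forall s t, 0 <= s -> 0 <= t -> g (s + t) = g s + g t) ->
  forall s, 0 <= s -> g s = s * g 1.
Proof.
move=> g0 gD.
have gM (k : nat) s : 0 <= s -> g (k%:R * s) = k%:R * g s.
  move=> s0; elim: k => [|k IHk].
    by have := gD 0 0 (lexx _) (lexx _); rewrite !addr0 mul0r => h; rewrite mul0r; lra.
  by rewrite -natr1 mulrDl mul1r gD ?mulr_ge0// IHk mulrDl mul1r.
have gle s t : 0 <= s -> s <= t -> g s <= g t.
  by move=> s0 st; rewrite -(subrK s t) gD ?subr_ge0// lerDr g0// subr_ge0.
move=> s s0; apply/eqP; rewrite -subr_eq0 -normr_le0; apply/ler_addgt0Pr => e e0; rewrite add0r.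
have g1 := g0 1 ler01.
(* This [N] makes g(1/(N+1)) = g(1)/(N+1) at most [e]. *)
have [N _ /(_ N (leqnn N))/= Ne] :=
  near_infty_natSinv_lt (PosNum (divr_gt0 e0 (ltr_pwDl ltr01 g1))).
have N0 : 0 < N.+1%:R :> R by [].
have gN : g 1 = N.+1%:R * g N.+1%:R^-1 by rewrite -gM ?invr_ge0// divff// gt_eqF.
pose k := Num.truncn (s * N.+1%:R).
have /andP[ks sk] : k%:R <= s * N.+1%:R < k.+1%:R.
  by apply: truncn_itv; rewrite mulr_ge0.
have gi := g0 N.+1%:R^-1 (ltW (etrans (invr_gt0 _) N0)).
have lo : k%:R * g N.+1%:R^-1 <= g s.
  by rewrite -gM ?invr_ge0//; apply: gle; rewrite ?mulr_ge0 ?invr_ge0// ler_pdivrMr.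
have hi : g s <= k.+1%:R * g N.+1%:R^-1.
  by rewrite -gM ?invr_ge0//; apply: gle => //; rewrite ler_pdivlMr// ltW.
have lo' : k%:R * g N.+1%:R^-1 <= s * g 1 by rewrite gN mulrA ler_wpM2r.
have hi' : s * g 1 <= k.+1%:R * g N.+1%:R^-1 by rewrite gN mulrA ler_wpM2r// ltW.
have ge : g N.+1%:R^-1 <= e.
  rewrite -(ler_pM2l N0) -gN; move: Ne.
  rewrite invf_plt ?posrE ?divr_gt0 ?ltr_pwDl// invf_div ltr_pdivrMr//.
  by move=> h; apply: ltW; apply: le_lt_trans h; lra.
rewrite -natr1 mulrDl mul1r in hi hi'.
by rewrite ler_norml; apply/andP; split; lra.
Qed.

Definition hadamard (R : realType) (p q : nat) (s x : 'M[R]_(p, q)) : 'M[R]_(p, q) :=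
  \matrix_(i, j) (s i j * x i j).

Section translation_invariant.
Context (R : realType) (p q : nat) (h : {outer_measure set 'M[R]_(p, q) -> \bar R}).

Hypothesis h_trans : forall (v : 'M[R]_(p, q)) (A : set 'M[R]_(p, q)), h [set v + x | x in A] = h A.
Hypothesis h_sep : forall i j (c c' : R) (A B : set 'M[R]_(p, q)), c < c' ->
  (forall x : 'M[R]_(p, q), A x -> x i j <= c) ->
  (forall x : 'M[R]_(p, q), B x -> c' <= x i j) -> (h A + h B <= h (A `|` B))%E.
Hypothesis h_box_fin : forall a b, (h (box a b) < +oo)%E.

(** Additivity across slabs makes the half-spaces Caratheodory measurable, and they generate the
    Borel sets. *)
Lemma borel_mx_caratheodory (A : set (borel_mx R p q)) :
  measurable A -> h.-caratheodory (A : set 'M[R]_(p, q)).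
Proof.
move=> mA.
have := @borel_mx_sub R p q h.-caratheodory _ A mA.
have carah i j c : <<s h.-caratheodory >> [set x : 'M[R]_(p, q) | c <= x i j].
  apply: sub_sigma_algebra; apply: (@separated_caratheodory R _ h (fun x : 'M[R]_(p, q) => x i j)).
  exact: h_sep.
move=> /(_ carah); apply: smallest_sub; last by [].
exact: (@sigma_algebra_measurable _ (caratheodory_type h)).
Qed.

Lemma borel_restriction_ex :
  exists mu : {measure set (borel_mx R p q) -> \bar R}, forall A, mu A = h A.
Proof.
have mid : measurable_fun setT
    (id : caratheodory_type h -> borel_mx R p q).
  by move=> _ A mA; rewrite setTI; exact: borel_mx_caratheodory.
by have [mu Hmu] := pushforward_measure_ex
  (h : {measure set (caratheodory_type h) -> \bar R}) mid; exists mu.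
Qed.

Let upd (b : 'M[R]_(p, q)) (k : 'I_p * 'I_q) (v : R) : 'M[R]_(p, q) :=
  \matrix_(i, j) if (i, j) == k then v else b i j.

(** With the other sides fixed, the mass of a box is an additive function of the length of side [k],
    hence linear by [additive_linear]. *)
Lemma box_side (a b : 'M[R]_(p, q)) (k : 'I_p * 'I_q) : a k.1 k.2 <= b k.1 k.2 ->
  (h (box a b) = (b k.1 k.2 - a k.1 k.2)%R%:E * h (box a (upd b k (a k.1 k.2 + 1)%R)))%E.
Proof.
move=> ab.
pose B s := box a (upd b k (a k.1 k.2 + s)).
have hBfin s : h (B s) \is a fin_num.
  by rewrite ge0_fin_numE ?outer_measure_ge0// h_box_fin.
pose g s := fine (h (B s)).
have -> : box a b = B (b k.1 k.2 - a k.1 k.2).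
  congr box; apply/matrixP => i j; rewrite mxE addrC subrK.
  by case: eqP => // <-.
rewrite -/(B 1) -(fineK (hBfin 1)) -(fineK (hBfin _)) -EFinM.
congr EFin; apply: (@additive_linear _ g); last by rewrite subr_ge0.
  by move=> s _; apply: fine_ge0; exact: outer_measure_ge0.
move=> s t s0 t0; apply: EFin_inj; rewrite EFinD /g !fineK// addeC.
have car : h.-caratheodory [set x : 'M[R]_(p, q) | a k.1 k.2 + s <= x k.1 k.2].
  by apply: borel_mx_caratheodory; exact: measurable_halfspace.
(* Of the two pieces cut off at this level, the upper one is a translate of [B t] and the lower one
   is [B s]. *)
rewrite (car (B (s + t))); congr (_ + _)%E.
  rewrite -(h_trans (upd 0 k s) (B t)); congr (h _); apply/seteqP; split=> x.
    move=> [Bx skx]; exists (x - upd 0 k s); last by rewrite addrC subrK.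
    move=> i j; have := Bx i j; rewrite !mxE; case: eqP => [kE|_]; last first.
      by rewrite subr0.
    move: skx; rewrite -kE /= => h1 /andP[_ h2].
    by apply/andP; split; lra.
  move=> [y By <-]; split=> [i j|] /=; rewrite !mxE.
    have := By i j; rewrite !mxE; case: eqP => [kE|_]; last by rewrite add0r.
    by move=> /andP[h1 h2]; rewrite -kE/= in h1 h2 *; apply/andP; split; lra.
  have := By k.1 k.2; rewrite !mxE -surjective_pairing eqxx => /andP[h1 h2].
  lra.
congr (h _); apply/seteqP; split=> x.
  move=> [Bx /negP skx] i j; have := Bx i j; rewrite !mxE; case: eqP => // kE.
  move: skx; rewrite -kE/= -ltNge => -> /andP[-> _].
  by [].
move=> Bx; split=> [i j|] /=.
  have := Bx i j; rewrite !mxE; case: eqP => // _ /andP[-> h1] /=.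
  by rewrite (lt_le_trans h1)// lerD2l lerDl.
apply/negP; rewrite -ltNge; have := Bx k.1 k.2; rewrite !mxE -surjective_pairing eqxx.
by case/andP.
Qed.

Lemma box_formula (a b : 'M[R]_(p, q)) : (forall i j, a i j <= b i j) ->
  (h (box a b) = (\prod_(k : 'I_p * 'I_q) (b k.1 k.2 - a k.1 k.2))%:E
                 * h (box 0%R (const_mx 1%R)))%E.
Proof.
move=> ab.
(* In [bs s] the sides listed in [s] have already been replaced by unit sides. *)
pose bs (s : seq ('I_p * 'I_q)) : 'M[R]_(p, q) :=
  \matrix_(i, j) if (i, j) \in s then a i j + 1 else b i j.
have main (s : seq ('I_p * 'I_q)) : uniq s ->
    (h (box a b) = (\prod_(k <- s) (b k.1 k.2 - a k.1 k.2))%:E * h (box a (bs s)))%E.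
  elim: s => [_|k s IHs /= /andP[ks us]].
    rewrite big_nil mul1e; congr (h (box _ _)).
    by apply/matrixP => i j; rewrite mxE in_nil.
  have bsk : bs s k.1 k.2 = b k.1 k.2.
    by rewrite mxE -surjective_pairing (negbTE ks).
  rewrite IHs// (@box_side _ (bs s) k) bsk// muleA -EFinM big_cons mulrC.
  congr (_ * h (box _ _))%E; apply/matrixP => i j.
  by rewrite !mxE inE; case: eqP => [<-|].
rewrite (main (enum [set: 'I_p * 'I_q]%SET)) ?enum_uniq//.
rewrite big_enum/=; under eq_bigl do rewrite inE.
congr (_ * _)%E; rewrite -(h_trans a (box 0 _)); congr (h _).
apply/seteqP; split=> x.
  move=> Bx; exists (x - a); last by rewrite addrC subrK.
  move=> i j; have := Bx i j; rewrite !mxE mem_enum inE => /andP[h1 h2].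
  by apply/andP; split; lra.
move=> [y By <-] i j; have := By i j; rewrite !mxE mem_enum inE => /andP[h1 h2].
by apply/andP; split; lra.
Qed.

(** Both sides are measures in [A]: the pushforward of [h] under the inverse scaling, and a multiple
    of [h]. They agree on boxes by [box_formula]. *)
Lemma scaling_formula (s : 'M[R]_(p, q)) (A : set (borel_mx R p q)) :
  (forall i j, 0 < s i j) -> measurable A ->
  (h (hadamard s @` A) =
   (\prod_(k : 'I_p * 'I_q) s k.1 k.2)%:E * h A)%E.
Proof.
move=> s0 mA.
have [mu muE] := borel_restriction_ex.
pose D (x : borel_mx R p q) : borel_mx R p q :=
  \matrix_(i, j) ((s i j)^-1 * (x : 'M[R]_(p, q)) i j).
have mD : measurable_fun setT D.
  apply: measurable_mx => i j; rewrite /D.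
  under eq_fun do rewrite mxE.
  by apply: measurable_funM => //; exact: measurable_coord.
have [m1 m1E] := pushforward_measure_ex mu mD.
have sprod0 : 0 <= \prod_(k : 'I_p * 'I_q) s k.1 k.2.
  by apply: prodr_ge0 => k _; exact: ltW.
pose m2 : {measure set _ -> \bar R} := mscale (NngNum sprod0) mu.
have preD (B : set 'M[R]_(p, q)) :
    D @^-1` B = hadamard s @` B.
  apply/seteqP; split=> x /=.
    move=> BDx; exists (D x) => //; apply/matrixP => i j; rewrite !mxE.
    by rewrite mulrA divff ?mul1r// gt_eqF.
  move=> [y By <-]; rewrite (_ : D _ = y)//; apply/matrixP => i j.
  by rewrite !mxE mulrA mulVf ?mul1r// gt_eqF.
have : m1 A = m2 A.
  apply: box_unique => // a b.
    rewrite m1E muE preD; apply: le_lt_trans (h_box_fin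
     (hadamard s a) (hadamard s b)).
    apply: le_outer_measure => _ [x Bx <-] i j; rewrite !mxE.
    by have := Bx i j; rewrite ler_pM2l// ltr_pM2l.
  rewrite m1E muE /m2/= /mscale/= muE preD.
  have -> : hadamard s @` box a b =
      box (hadamard s a) (hadamard s b).
    apply/seteqP; split=> [_ [x Bx <-]|x Bx].
      by move=> i j; rewrite !mxE; have := Bx i j; rewrite ler_pM2l// ltr_pM2l.
    exists (D x).
      move=> i j; have := Bx i j; rewrite !mxE.
      by rewrite -ler_pdivlMl// -ltr_pdivrMl.
    apply/matrixP => i j; rewrite !mxE.
    by rewrite mulrA divff ?mul1r// gt_eqF.
  have [ab|/existsNP[i /existsNP[j /negP]]] := pselect (forall i j, a i j <= b i j).
    rewrite (box_formula ab) (@box_formula (hadamard s a)) => [|i j]; last first.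
      by rewrite !mxE ler_pM2l.
    rewrite muleA -EFinM -big_split/=; congr (_%:E * _)%E.
    by apply: eq_bigr => k _; rewrite !mxE mulrBr.
  rewrite -ltNge => ba.
  have -> : box a b = set0.
    apply/seteqP; split=> // x /(_ i j) /andP[h1 h2].
    by have := lt_trans (le_lt_trans h1 h2) ba; rewrite ltxx.
  rewrite outer_measure0 mule0.
  rewrite (_ : box _ _ = set0) ?outer_measure0//; apply/seteqP; split=> // x.
  move=> /(_ i j); rewrite !mxE => /andP[h1 h2].
  by have := le_lt_trans h1 h2; rewrite ltr_pM2l// ltNge ltW.
by rewrite m1E muE preD => ->; rewrite /m2/= /mscale/= muE.
Qed.

End translation_invariant.

(** * Independent families *)

Section independence.
Context d (T : measurableType d) (R : realType) (P : probability T R).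

Lemma measurable_RV_preimage d' (E : measurableType d') (X : {RV P >-> E}) (B : set E) :
  measurable B -> measurable (X @^-1` B).
Proof. by move=> mB; rewrite -[X in measurable X]setTI; exact: measurable_funPT. Qed.

(** The product formula for a subfamily [J] is that of the full family with the sure event chosen
    outside [J]. *)
Lemma independent_RVsP (I : finType) d' (E : measurableType d') (X : I -> {RV P >-> E}) :
  independent_RVs X <->
  (forall B : I -> set E, (forall i, measurable (B i)) ->
    P [set w | forall i, B i (X i w)] = (\prod_i P (X i @^-1` B i))%E).
Proof.
split=> [indX B mB|prodX J B mB].
  have := indX [set: I]%SET B mB; under eq_bigl do rewrite inE.
  move=> <-; congr (P _); apply/seteqP; split=> w /= H i; first by move=> _; exact: H.
  by apply: (H i); rewrite /= inE.
pose B' i := if i \in J then B i else setT.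
have mB' i : measurable (B' i) by rewrite /B'; case: ifP.
have := prodX B' mB'.
rewrite (bigID (mem J))/= [X in (_ * X)%E]big1 => [|i /negbTE iJ]; last first.
  by rewrite /B' iJ preimage_setT probability_setT.
rewrite mule1 => PJ.
rewrite [RHS](_ : _ = (\prod_(i in J) P (X i @^-1` B' i))%E); last first.
  by apply: eq_bigr => i iJ; rewrite /B' iJ.
rewrite -PJ; congr (P _); apply/seteqP; split=> w /= H i.
  by rewrite /B'; case: ifPn => // iJ; exact: H.
by move=> iJ; have := H i; rewrite /B' iJ.
Qed.

End independence.

(** Induction through binary products: a new factor [E] carries the variable of index 0, and the old
    space carries the others. *)
Lemma iid_ex (R : realType) d (E : measurableType d) (mu : probability E R) (n : nat) :
  exists d' (T : measurableType d') (P : probability T R) (X : 'I_n -> {RV P >-> E}),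
    independent_RVs X /\ forall i A, measurable A -> distribution P (X i) A = mu A.
Proof.
elim: n => [|n [d' [T [P [X [indX lawX]]]]]].
  (* The empty family lives on any space; [E] with [mu] is at hand. *)
  have no (i : 'I_0) : False by case: i.
  exists d, E, mu, (fun i => False_rect _ (no i)); split; last by case.
  apply/independent_RVsP => B _; rewrite big_ord0.
  rewrite (_ : [set _ | _] = setT) ?probability_setT//.
  by apply/seteqP; split=> // w _ [].
pose X0 (i : 'I_n.+1) (w : E * T) : E := if unlift ord0 i is Some k then X k w.2 else w.1.
have mX0 i : measurable_fun setT (X0 i).
  rewrite /X0; case: unliftP => [k _|_]; last exact: measurable_fst.
  exact: measurableT_comp (measurable_funPT (X k)) measurable_snd.
pose P' : probability (E * T)%type R := (mu \x P)%E.
pose X' (i : 'I_n.+1) : {RV P' >-> E} := mfun_Sub (mem_set (mX0 i)).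
have P'X A B : measurable A -> measurable B -> P' (A `*` B) = (mu A * P B)%E.
  exact: product_measure1E.
have X'0 A : measurable A -> P' (X' ord0 @^-1` A) = mu A.
  move=> mA; rewrite (_ : _ @^-1` _ = A `*` setT).
    by rewrite P'X// -[RHS]mule1 -(probability_setT P).
  by apply/seteqP; split=> -[x w]; rewrite /= /X0 unlift_none// => -[].
have X'S i A : measurable A -> P' (X' (lift ord0 i) @^-1` A) = P (X i @^-1` A).
  move=> mA; rewrite (_ : X' _ @^-1` _ = setT `*` (X i @^-1` A)).
    rewrite P'X//; last exact: measurable_RV_preimage.
    by rewrite -[RHS]mul1e -(probability_setT mu).
  by apply/seteqP; split=> -[x w]; rewrite /= /X0 liftK// => -[].
exists (measure_prod_display (d, d')), (E * T)%type, P', X'; split; last first.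
  move=> i A mA; rewrite /distribution /pushforward.
  by case: (unliftP ord0 i) => [k ->|->]; rewrite ?X'0 ?X'S//; exact: lawX.
apply/independent_RVsP => B mB; rewrite big_ord_recl X'0//.
under eq_bigr do rewrite X'S//.
move/independent_RVsP : indX => /(_ (fun i => B (lift ord0 i)) (fun i => mB _)) <-.
rewrite (_ : [set _ | _] = B ord0 `*` [set w | forall i, B (lift ord0 i) (X i w)]).
  rewrite P'X//.
  rewrite (_ : [set w | _] = \bigcap_(i in setT) (X i @^-1` B (lift ord0 i))).
    by apply: fin_bigcap_measurable => // i _; exact: measurable_RV_preimage.
  by apply/seteqP; split=> w /= H i; [move=> _; exact: H|exact: (H i)].
apply/seteqP; split=> -[x w] /=.
  move=> H; split=> [|i]; first by have := H ord0; rewrite /X0 unlift_none.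
  by have := H (lift ord0 i); rewrite /X0 liftK.
move=> [Hx Hw] i; rewrite /X0; case: unliftP => [k ->|->//]; exact: Hw.
Qed.

(** * The Hausdorff measure in an affine chart *)

Lemma coord_le_eucl_dist (R : realType) (m n : nat) (x y : 'M[R]_(m, n)) i j :
  `|x i j - y i j| <= eucl_dist x y.
Proof.
rewrite -sqrtr_sqr; apply: ler_wsqrtr.
rewrite (bigD1 i)//= (bigD1 j)//= -addrA lerDl addr_ge0//.
  by apply: sumr_ge0 => *; exact: sqr_ge0.
by apply: sumr_ge0 => *; apply: sumr_ge0 => *; exact: sqr_ge0.
Qed.

Lemma eucl_dist_le (R : realType) (m n : nat) (x y : 'M[R]_(m, n)) (r : R) :
  (forall i j, `|x i j - y i j| <= r) -> 0 <= r -> eucl_dist x y <= (m * n)%:R * r.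
Proof.
move=> xyr r0; rewrite -(ger0_norm (mulr_ge0 (ler0n _ _) r0)) -sqrtr_sqr.
apply: ler_wsqrtr; apply: (@le_trans _ _ ((m * n)%:R * r ^+ 2)).
  apply: (@le_trans _ _ (\sum_(i < m) \sum_(j < n) r ^+ 2)); last first.
    by rewrite !sumr_const !card_ord -mulrnA mulr_natl mulnC.
  apply: ler_sum => i _; apply: ler_sum => j _.
  by rewrite -real_normK ?num_real// lerXn2r// nnegrE.
rewrite exprMn ler_wpM2r ?sqr_ge0//; case: (m * n)%N => [|N].
  by rewrite expr0n.
by rewrite expr2 ler_peMr ?ler0n// ler1n.
Qed.

Section chart.
Context (R : realType) (k m : nat).
Implicit Types (x y v : 'M[R]_(k, m)) (A : set 'M[R]_(k, m)).

(* An affine chart of the space of matrices whose rows sum to 1. *)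
Definition chart x : 'M[R]_(k, m.+1) :=
  \matrix_(i, j) if unlift ord0 j is Some l then x i l else 1 - \sum_l x i l.

Lemma chart0 x i : chart x i ord0 = 1 - \sum_l x i l.
Proof. by rewrite mxE unlift_none. Qed.

Lemma chartS x i l : chart x i (lift ord0 l) = x i l.
Proof. by rewrite mxE liftK. Qed.

Lemma chart_sum x i : \sum_j chart x i j = 1.
Proof.
by rewrite big_ord_recl chart0; under [X in _ + X]eq_bigr do rewrite chartS; rewrite subrK.
Qed.

Lemma chart_surj (z : 'M[R]_(k, m.+1)) : (forall i, \sum_j z i j = 1) ->
  chart (\matrix_(i, l) z i (lift ord0 l)) = z.
Proof.
move=> z1; apply/matrixP => i j; case: (unliftP ord0 j) => [l ->|->].
  by rewrite chartS mxE.
rewrite chart0 -(z1 i) big_ord_recl; under [X in _ - X]eq_bigr do rewrite mxE.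
by rewrite addrK.
Qed.

(** The linear part of the affine map [chart]; its rows sum to 0. *)
Let shift v : 'M[R]_(k, m.+1) :=
  \matrix_(i, j) if unlift ord0 j is Some l then v i l else - \sum_l v i l.

Lemma chart_translate v x : chart (v + x) = shift v + chart x.
Proof.
apply/matrixP => i j; rewrite !mxE; case: unliftP => [l _|_]; first by rewrite mxE.
under eq_bigr do rewrite mxE.
by rewrite big_split/= opprD addrCA.
Qed.

(** The chart is Lipschitz: the dependent entry moves by at most m times [r], and [eucl_dist_le]
    passes from entries to the distance. *)
Lemma eucl_dist_chart_le x y r : (forall i j, `|x i j - y i j| <= r) -> 0 <= r ->
  eucl_dist (chart x) (chart y) <= (k * m.+1 * m.+1)%:R * r.
Proof.
move=> xyr r0; rewrite natrM -mulrA; apply: eucl_dist_le; last by rewrite mulr_ge0.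
move=> i j; case: (unliftP ord0 j) => [l ->|->].
  by rewrite !chartS (le_trans (xyr i l))// ler_peMl// ler1n.
rewrite !chart0 (_ : _ - _ = \sum_l (y i l - x i l)); last by rewrite sumrB; ring.
apply: le_trans (ler_norm_sum _ _ _) _.
apply: (@le_trans _ _ (\sum_(l < m) r)).
  by apply: ler_sum => l _; rewrite distrC.
by rewrite sumr_const card_ord -(mulr_natl r) ler_wpM2r// ler_nat.
Qed.

(** For k = m + 1 = n, the dimension k m is n(n-1), that of the Markov polytope. *)
Definition chart_hausdorff A : \bar R := hausdorff (k * m) (chart @` A).

Lemma chart_hausdorff0 : chart_hausdorff set0 = 0%E.
Proof. by rewrite /chart_hausdorff image_set0 outer_measure0. Qed.

Lemma chart_hausdorff_ge0 A : (0 <= chart_hausdorff A)%E.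
Proof. exact: hausdorff_ge0. Qed.

Lemma le_chart_hausdorff : {homo chart_hausdorff : A B / A `<=` B >-> (A <= B)%E}.
Proof. by move=> A B AB; apply: le_hausdorff; exact: image_subset. Qed.

Lemma chart_hausdorff_sigma_subadditive : sigma_subadditive chart_hausdorff.
Proof.
move=> F; rewrite /chart_hausdorff image_bigcup.
exact: hausdorff_sigma_subadditive.
Qed.

HB.instance Definition _ := isOuterMeasure.Build R 'M[R]_(k, m) chart_hausdorff
  chart_hausdorff0 chart_hausdorff_ge0 le_chart_hausdorff
  chart_hausdorff_sigma_subadditive.

Lemma chart_hausdorff_translate v A :
  chart_hausdorff [set v + x | x in A] = chart_hausdorff A.
Proof.
rewrite /chart_hausdorff -(@hausdorff_isometry _ _ _ _ (fun z => shift v + z)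
  (fun z => - shift v + z) (chart @` A)).
- rewrite !image_comp; congr (hausdorff _ _); apply/seteqP.
  by split=> _ [x Ax <-]; exists x => //=; rewrite chart_translate.
- move=> x y; congr Num.sqrt; apply: eq_bigr => i _; apply: eq_bigr => j _.
  have addE z : (shift v + z) i j = shift v i j + z i j by rewrite mxE.
  by rewrite !addE; ring.
- by move=> z; rewrite addKr.
- by move=> z; rewrite addNKr.
Qed.

(** The coordinates of [x] remain entries of [chart x], so a gap in one of them is a gap in
    Euclidean distance. *)
Lemma chart_hausdorff_separated i j (c c' : R) A B : c < c' ->
  (forall x, A x -> x i j <= c) -> (forall x, B x -> c' <= x i j) ->
  (chart_hausdorff A + chart_hausdorff B <= chart_hausdorff (A `|` B))%E.
Proof.
move=> cc' Ac Bc; rewrite /chart_hausdorff image_setU.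
apply: (@hausdorff_separated _ _ _ _ (c' - c)); first by rewrite subr_gt0.
move=> _ _ [x Ax <-] [y By <-].
apply: le_trans (coord_le_eucl_dist _ _ i (lift ord0 j)).
rewrite !chartS distrC (le_trans _ (ler_norm _))// lerB//; [exact: Bc|exact: Ac].
Qed.

(** The box lies in a cube of side 2N. Cutting that cube into (s+1)^(k m) cells of side 2N/(s+1)
    gives covers whose cost stays below one bound for all meshes. *)
Lemma chart_hausdorff_box_fin (a b : 'M[R]_(k, m)) : (chart_hausdorff (box a b) < +oo)%E.
Proof.
pose N := maxn (Num.truncn `|a|).+1 (Num.truncn `|b|).+1.
pose C : R := (k * m.+1 * m.+1)%:R.
pose r s : R := (N.*2)%:R / s.+1%:R.
suff bound : (chart_hausdorff (box a b) <= ((C * (N.*2)%:R) ^+ (k * m))%:E)%E.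
  by rewrite (le_lt_trans bound)// ltry.
apply: ge_ereal_sup => _ [delta /= delta0 <-].
have [s _ /(_ s (leqnn s))/= Hs] :
    exists2 s : nat, True & forall t, (s <= t)%N -> C * r t <= delta.
  (* Adding 1 keeps the denominator positive even when [C] is 0. *)
  have CN0 : 0 < C * (N.*2)%:R + 1 by rewrite ltr_wpDl// mulr_ge0.
  have [s _ Hs] := near_infty_natSinv_lt (PosNum (divr_gt0 delta0 CN0)).
  exists s => // t st; rewrite /r mulrA; have := Hs t st; rewrite /= => /ltW.
  rewrite ler_pdivlMr// => h.
  by rewrite mulrC; apply: le_trans h; rewrite ler_wpM2l// lerDl.
pose I := {ffun 'I_k * 'I_m -> 'I_s.+1}.
pose lo (f : I) : 'M[R]_(k, m) := \matrix_(i, j) (- N%:R + (f (i, j))%:R * r s).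
pose hi (f : I) : 'M[R]_(k, m) := \matrix_(i, j) (- N%:R + (f (i, j)).+1%:R * r s).
have N0 : 0 < (N.*2)%:R :> R by rewrite ltr0n double_gt0 /N leq_max.
have r0 : 0 < r s by rewrite divr_gt0.
have rs : s.+1%:R * r s = (N.*2)%:R by rewrite /r mulrC divfK.
have Cr0 : 0 <= C * r s by rewrite mulr_ge0// ltW.
apply: le_trans (@hausdorff_pre_cover R k m.+1 (k * m) delta (C * r s) I
    (fun f => chart @` box (lo f) (hi f)) _ Cr0 Hs _ _) _.
- move=> f; apply: ge_ereal_sup => _ [[_ _] [/= [x Bx <-] [y By <-]] <-].
  rewrite lee_fin; apply: eucl_dist_chart_le; last exact: ltW.
  move=> i j; have := Bx i j; have := By i j; rewrite !mxE -natr1 mulrDl mul1r.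
  by move=> /andP[h1 h2] /andP[h3 h4]; rewrite ler_norml; apply/andP; split; lra.
- move=> _ [x abx <-].
  have xN i j : - N%:R <= x i j < N%:R.
    have /andP[ax xb] := abx i j.
    have := coord_lt_truncn a i j; rewrite ltr_norml => /andP[ha _].
    have := coord_lt_truncn b i j; rewrite ltr_norml => /andP[_ hb].
    rewrite (le_trans _ ax)/=; last first.
      by rewrite (le_trans _ (ltW ha))// lerN2 ler_nat leq_maxl.
    by rewrite (lt_le_trans xb)// (le_trans (ltW hb))// ler_nat leq_maxr.
  (* The truncation of this quotient is the index, in direction [ij], of the cell containing [x]. *)
  have pos ij : 0 <= (x ij.1 ij.2 + N%:R) / r s.
    by rewrite divr_ge0 ?(ltW r0)//; have /andP[h _] := xN ij.1 ij.2; lra.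
  have small ij : (Num.truncn ((x ij.1 ij.2 + N%:R) / r s) < s.+1)%N.
    have /andP[h1 _] := truncn_itv (pos ij).
    rewrite -(ltr_nat R); apply: le_lt_trans h1 _.
    rewrite ltr_pdivrMr// /r mulrC divfK// -addnn natrD.
    by have /andP[_ h] := xN ij.1 ij.2; lra.
  exists [ffun ij => Ordinal (small ij)] => //; exists x => // i j.
  rewrite !mxE !ffunE /=.
  have /andP[h1 h2] := truncn_itv (pos (i, j)).
  move: h1 h2; rewrite ler_pdivlMr// ltr_pdivrMr//= => h1 h2.
  by apply/andP; split; lra.
- rewrite lee_fin card_ffun card_prod !card_ord natrX -exprMn.
  by rewrite lerXn2r ?nnegrE ?mulr_ge0// mulrCA rs.
Qed.

(** Mass distribution principle: when [U] has independent uniform entries, [chart (U w)] falls into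
    a set of diameter r with probability at most (2r)^(k m), so every cover costs at least 2^-(k
    m). *)
Lemma chart_hausdorff_unit_gt0 : (0 < chart_hausdorff (box 0%R (const_mx 1%R)))%E.
Proof.
(* The uniform entries range over the closed unit cube, which the half-open box of side 2 contains;
   [box_formula] relates the two boxes. *)
suff : (0 < chart_hausdorff (box 0%R (const_mx 2%R)))%E.
  rewrite (box_formula chart_hausdorff_translate chart_hausdorff_separated)//.
  - by rewrite !lt0e mule_eq0 negb_or => /andP[/andP[_ ->] _] /=; exact: outer_measure_ge0.
  - exact: chart_hausdorff_box_fin.
  - by move=> i j; rewrite !mxE.
have [d [T [P [X [indX lawX]]]]] :=
  iid_ex (uniform_prob (@ltr01 R)) #|{: 'I_k * 'I_m}|.
pose U w : 'M[R]_(k, m) := \matrix_(i, j) X (enum_rank (i, j)) w.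
have PU (B : 'I_k * 'I_m -> set R) : (forall ij, measurable (B ij)) ->
    P [set w | forall ij, B ij (U w ij.1 ij.2)] =
    (\prod_ij uniform_prob (@ltr01 R) (B ij))%E.
  move=> mB; have /independent_RVsP /(_ (fun t => B (enum_val t)) (fun t => mB _)) := indX.
  rewrite (_ : [set w | _] = [set w | forall ij, B ij (U w ij.1 ij.2)]).
    move=> ->; rewrite [RHS](reindex (fun t : 'I_#|{: 'I_k * 'I_m}| => enum_val t))/=; last first.
      exact/onW_bij/enum_val_bij.
    by apply: eq_bigr => t _; exact: (lawX t _ (mB _)).
  apply/seteqP; split=> w /= H.
    move=> ij; have := H (enum_rank ij).
    by rewrite enum_rankK mxE -surjective_pairing.
  move=> t; have := H (enum_val t).
  by rewrite mxE -surjective_pairing enum_valK.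
have mU (B : 'I_k * 'I_m -> set R) : (forall ij, measurable (B ij)) ->
    measurable [set w | forall ij, B ij (U w ij.1 ij.2)].
  move=> mB; rewrite [X in measurable X](_ : _ = \bigcap_(ij in setT)
    (X (enum_rank ij) @^-1` B ij)).
    by apply: fin_bigcap_measurable => // ij _; apply: measurable_RV_preimage; exact: mB.
  by apply/seteqP; split=> w /= H ij; [move=> _; have := H ij|have := H ij Logic.I];
    rewrite mxE -surjective_pairing.
have unif_le (c r : R) : 0 <= r ->
    (uniform_prob (@ltr01 R) `[(c - r)%R, (c + r)%R] <= (2 * r)%:E)%E.
  move=> r0; apply: (@le_trans _ _ (\int[lebesgue_measure]_(x in `[(c - r)%R, (c + r)%R]) 1)%E).
    apply: ge0_le_integral => //=.
    - by move=> x _; rewrite lee_fin uniform_pdf_ge0.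
    - by apply/measurable_EFinP/measurable_funTS; exact: measurable_uniform_pdf.
    - by move=> x _; rewrite lee_fin /uniform_pdf; case: ifP => // _; rewrite subr0 invr1.
  rewrite integral_cst//= mul1e lebesgue_measure_itv/= lte_fin.
  case: ifP => [_|_]; last by rewrite lee_fin mulr_ge0.
  by rewrite -EFinB lee_fin; lra.
pose c : R := 2 ^+ (k * m).
have c0 : 0 < c by exact: exprn_gt0.
have /lt_le_trans : (0 < ((c^-1)%:E : \bar R))%E by rewrite lte_fin invr_gt0.
(* Mesh 1 is enough for a lower bound, and it makes all diameters finite. *)
apply; rewrite /chart_hausdorff; apply: le_trans (hausdorff_pre_le _ _ (@ltr01 R)).
apply: le_ereal_inf_tmp => _ [F [FU F1] <-].
rewrite -[leLHS]mule1 lee_pdivrMl//.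
rewrite -nneseriesZl; last by move=> i _; exact: diam_pow_ge0.
(* The pieces [F i] are arbitrary sets, so hitting [F i] is enclosed in a measurable event [V i]:
   that [U] falls into a cube around one point of the piece, with half-side its diameter. *)
have /choice[V HV] : forall i, exists V : set T,
    [/\ measurable V, forall w, F i (chart (U w)) -> V w &
     (P V <= c%:E * diam_pow (k * m) (F i))%E].
  move=> i; have [[x Fx]|nF] := pselect (exists x, F i (chart x)); last first.
    exists set0; split => // [w Fw|]; first by apply: nF; exists (U w).
    by rewrite measure0 mule_ge0 ?diam_pow_ge0// lee_fin ltW.
  have D0 : (0 <= diameter (F i))%E.
    by rewrite -[0%E]/(0%R%:E) -(eucl_distxx (chart x)) eucl_dist_le_diameter.
  have Dfin : diameter (F i) \is a fin_num.
    by rewrite ge0_fin_numE// (le_lt_trans (F1 i))// ltry.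
  pose r := fine (diameter (F i)).
  have r0 : 0 <= r by exact: fine_ge0.
  pose B (ij : 'I_k * 'I_m) :=
    (`[x ij.1 ij.2 - r, x ij.1 ij.2 + r] : set R)%classic.
  exists [set w | forall ij, B ij (U w ij.1 ij.2)]; split.
    by apply: mU => ij; exact: measurable_itv.
    move=> w Fw ij; rewrite /B/= in_itv/= -ler_distl distrC.
    rewrite -(chartS x) -(chartS (U w)).
    apply: le_trans (coord_le_eucl_dist _ _ _ _) _.
    by rewrite -lee_fin fineK//; apply: eucl_dist_le_diameter.
  have -> : diam_pow (k * m) (F i) = (r ^+ (k * m))%:E.
    rewrite /diam_pow; case: eqP => [F0|_]; first by rewrite F0 in Fx.
    by rewrite EFin_expe fineK.
  rewrite PU => [|ij]; last exact: measurable_itv.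
  rewrite -EFinM /c -exprMn.
  have -> : ((2 * r) ^+ (k * m))%:E = (\prod_(ij : 'I_k * 'I_m) (2 * r)%:E)%E.
    by rewrite prodEFin prodr_const card_prod !card_ord.
  suff /andP[] : (0 <= \prod_ij uniform_prob (@ltr01 R) (B ij) <=
      \prod_(ij : 'I_k * 'I_m) (2 * r)%:E)%E by [].
  elim/big_rec2 : _ => [|ij y z _ /andP[z0 zy]]; first by rewrite lee01 lexx.
  by rewrite mule_ge0//= lee_pmul// unif_le.
have mV i : measurable (V i) by have [] := HV i.
apply: (@le_trans _ _ (\sum_(0 <= i <oo) P (V i))%E); last first.
  by apply: lee_nneseries => // i _; have [] := HV i.
have <- : P [set w | forall ij : 'I_k * 'I_m, (`[0, 1]%classic : set R) (U w ij.1 ij.2)] = 1%E.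
  rewrite (PU (fun=> `[0, 1]%classic)) => [|ij]; last exact: measurable_itv.
  by rewrite big1// => ij _; exact: integral_uniform_pdf1.
apply: measure_sigma_subadditive => //.
  by apply: (mU (fun=> `[0, 1]%classic)) => ij; exact: measurable_itv.
move=> w Uw; have : (chart @` box 0 (const_mx 2)) (chart (U w)).
  exists (U w) => // i j; have := Uw (i, j); rewrite /= in_itv/=.
  move: (U w i j) => u; rewrite !mxE => /andP[-> h]/=.
  by rewrite (le_lt_trans h)// ltr1n.
by move/FU => [i _ Fi]; exists i => //; have [_ + _] := HV i; exact.
Qed.

End chart.

(** * The uniform distribution on corners *)

(* The tail [P(X_j >= t_j for all j)] of the distribution D(1, .., 1). *)
Definition flat_tail (R : realType) (n : nat) (t : 'rV[R]_n) : R :=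
  let s := \sum_j Num.max (t ord0 j) 0 in
  if s <= 1 then (1 - s) ^+ n.-1 else 0.

(** Presents the polytope as a corner cut by the affine space that the chart parametrizes. *)
Lemma markov_matricesE (R : realType) (n : nat) (z : 'M[R]_n) :
  markov_matrices z <-> corner 0 z /\ forall i, \sum_j z i j = 1.
Proof.
split=> [Kz|[z0 z1] i].
  split=> [i j|i]; have [h1 h2] := Kz i.
    by have /andP[+ _] := h1 j; rewrite !mxE.
  by rewrite -[RHS]h2; apply: eq_bigr => j _; rewrite mxE.
have z0' j : 0 <= z i j by have := z0 i j; rewrite mxE.
split=> [j|]; last by rewrite -[RHS](z1 i); apply: eq_bigr => j _; rewrite mxE.
rewrite mxE z0'/= -(z1 i) (bigD1 j)//= lerDl.
by apply: sumr_ge0 => *; exact: z0'.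
Qed.

Section chart_corners.
Context (R : realType) (k m : nat).
Local Notation h := (@chart_hausdorff R k m).

Lemma measurable_chart :
  measurable_fun setT (@chart R k m : borel_mx R k m -> borel_mx R k m.+1).
Proof.
apply: measurable_mx => i j; case: (unliftP ord0 j) => [l ->|->].
  by under eq_fun do rewrite chartS; exact: measurable_coord.
under eq_fun do rewrite chart0.
apply: measurable_funB => //; apply: measurable_sum => l; exact: measurable_coord.
Qed.

Lemma measurable_chart_corner t :
  measurable (@chart R k m @^-1` corner t : set (borel_mx R k m)).
Proof.
rewrite -[X in measurable X]setTI; apply: measurable_chart => //.
exact: measurable_corner.
Qed.

Lemma chart_hausdorff_corner_fin t : (h (@chart R k m @^-1` corner t) < +oo)%E.
Proof.
pose a : 'M[R]_(k, m) := \matrix_(i, l) t i (lift ord0 l).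
(* Row sums bound the entry by the same expression with 1 in place of 2; the excess makes the
   inequality strict, boxes being open above. *)
pose b : 'M[R]_(k, m) := \matrix_(i, l) (2 - \sum_j t i j + t i (lift ord0 l)).
apply: le_lt_trans (chart_hausdorff_box_fin a b).
apply: le_outer_measure => x Cx i l; rewrite !mxE.
have -> /= : t i (lift ord0 l) <= x i l by have := Cx i (lift ord0 l); rewrite chartS.
have := chart_sum x i; rewrite (bigD1 (lift ord0 l))//= chartS => xE.
have : \sum_(j | j != lift ord0 l) t i j <= \sum_(j | j != lift ord0 l) chart x i j.
  by apply: ler_sum => j _; exact: Cx.
by rewrite [\sum_j t i j](bigD1 (lift ord0 l))//=; lra.
Qed.

(** The simplices contain a box of side 1/(m+1), as m such sides sum to at most 1. *)
Lemma chart_hausdorff_simplex_gt0 : (0 < h (@chart R k m @^-1` corner 0))%E.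
Proof.
pose r : R := m.+1%:R^-1.
have r0 : 0 < r by rewrite invr_gt0.
apply: (@lt_le_trans _ _ (h (box 0%R (const_mx r)))).
  rewrite (box_formula (@chart_hausdorff_translate R k m)
    (@chart_hausdorff_separated R k m) (@chart_hausdorff_box_fin R k m)).
    rewrite mule_gt0 ?chart_hausdorff_unit_gt0// lte_fin.
    by apply: prodr_gt0 => ij _; rewrite !mxE subr0.
  by move=> i j; rewrite !mxE ltW.
apply: le_outer_measure => x Bx i j; rewrite mxE.
have xr l : 0 <= x i l < r by have := Bx i l; rewrite !mxE.
case: (unliftP ord0 j) => [l ->|->]; first by rewrite chartS; case/andP: (xr l).
rewrite chart0 subr_ge0; apply: (@le_trans _ _ (\sum_(l < m) r)).
  by apply: ler_sum => l _; case/andP: (xr l) => _ /ltW.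
rewrite sumr_const card_ord -(mulr_natl r) /r ler_pdivrMr// mul1r.
by rewrite ler_nat.
Qed.

(** A scaling followed by a translation takes the standard simplices onto the corner; the m free
    coordinates of row [i] are scaled by the same ratio, whence the power m. *)
Lemma chart_hausdorff_corner_pos (t : 'M[R]_(k, m.+1)) :
  (forall i, \sum_j t i j < 1) ->
  (h (@chart R k m @^-1` corner t) =
   (\prod_i (1 - \sum_j t i j) ^+ m)%:E * h (@chart R k m @^-1` corner 0))%E.
Proof.
move=> t1; pose s i : R := 1 - \sum_j t i j.
have s0 i : 0 < s i by rewrite subr_gt0.
pose S : 'M[R]_(k, m) := \matrix_(i, l) s i.
pose v : 'M[R]_(k, m) := \matrix_(i, l) t i (lift ord0 l).
have -> : \prod_i (1 - \sum_j t i j) ^+ m = \prod_(ij : 'I_k * 'I_m) S ij.1 ij.2.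
  rewrite -(pair_big xpredT xpredT (fun i j => S i j))/=; apply: eq_bigr => i _.
  by under [RHS]eq_bigr do rewrite mxE; rewrite prodr_const card_ord.
rewrite -(scaling_formula (@chart_hausdorff_translate R k m)
    (@chart_hausdorff_separated R k m) (@chart_hausdorff_box_fin R k m)); last 2 first.
- by move=> i j; rewrite mxE.
- exact: measurable_chart_corner.
rewrite -[RHS](chart_hausdorff_translate v) image_comp; congr (h _).
(* The choice of the ratio [s i] makes the formula hold on the forgotten column too. *)
have chartE y i j : chart (v + hadamard S y) i j = t i j + s i * chart y i j.
  case: (unliftP ord0 j) => [l ->|->]; first by rewrite !chartS !mxE.
  rewrite !chart0; under eq_bigr do rewrite !mxE.
  by rewrite big_split/= -mulr_sumr /s big_ord_recl; ring.
apply/seteqP; split=> [x Cx|_ [y Cy <-]]; last first.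
  move=> i j; rewrite /= chartE lerDl mulr_ge0// ?(ltW (s0 i))//.
  by have := Cy i j; rewrite mxE.
pose y : 'M[R]_(k, m) := \matrix_(i, l) ((s i)^-1 * (x i l - v i l)).
have xE : v + hadamard S y = x.
  apply/matrixP => i l; rewrite !mxE mulrA divff ?gt_eqF// mul1r addrC subrK.
  by [].
exists y => // i j; rewrite mxE -(pmulr_rge0 _ (s0 i)).
by have := Cx i j; rewrite -xE chartE lerDl.
Qed.

Lemma chart_hausdorff_corner (t : 'M[R]_(k, m.+1)) : (forall i j, 0 <= t i j) ->
  (h (@chart R k m @^-1` corner t) =
   (\prod_i flat_tail (row i t))%:E * h (@chart R k m @^-1` corner 0))%E.
Proof.
move=> t0.
have tailE i : flat_tail (row i t) =
    if \sum_j t i j <= 1 then (1 - \sum_j t i j) ^+ m else 0.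
  rewrite /flat_tail /=.
  by under [in LHS]eq_bigr => j _ do rewrite mxE max_l//.
have [t1|/existsNP[i0 /negP]] := pselect (forall i, \sum_j t i j < 1).
  rewrite chart_hausdorff_corner_pos//; congr (_%:E * _)%E.
  by apply: eq_bigr => i _; rewrite tailE ltW.
rewrite -leNgt => ti0.
have [le1|/existsNP[i1 /negP]] := pselect (forall i, \sum_j t i j <= 1); last first.
  rewrite -ltNge => ti1.
  rewrite (bigD1 i1)//= tailE leNgt ti1/= mul0r mul0e.
  rewrite (_ : _ @^-1` _ = set0) ?outer_measure0//; apply/seteqP; split=> // x Cx.
  have := chart_sum x i1; apply/eqP; rewrite gt_eqF// (lt_le_trans ti1)//.
  by apply: ler_sum => j _; exact: Cx.
have ti0E : \sum_j t i0 j = 1 by apply/eqP; rewrite eq_le le1.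
have hfin : h (@chart R k m @^-1` corner 0) \is a fin_num.
  by rewrite ge0_fin_numE ?outer_measure_ge0// chart_hausdorff_corner_fin.
(* With a single column the tail at row sum 1 is 0^0 = 1: all entries in the chart equal 1, and both
   corners are the whole space. *)
have [m0|m_gt0] := posnP m.
  have ordE (a b : 'I_m.+1) : a = b.
    have ord_eq0 (l : 'I_m.+1) : l = 0%N :> nat.
      by apply/eqP; rewrite -leqn0 -m0 -ltnS.
    by apply: ord_inj; rewrite !ord_eq0.
  have expm0 (y : R) : y ^+ m = 1 by rewrite m0.
  rewrite big1 ?mul1e => [|i _]; last by rewrite tailE le1 expm0.
  have C1 (x : 'M[R]_(k, m)) i j : chart x i j = 1.
    rewrite -[RHS](chart_sum x i) (bigD1 j)//= big1 ?addr0// => j' /eqP[].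
    exact: ordE.
  congr (h _); apply/seteqP; split=> x Cx i j; rewrite C1 ?mxE//.
  by rewrite (le_trans _ (le1 i))// (bigD1 j)//= lerDl sumr_ge0.
rewrite (bigD1 i0)//= tailE le1 ti0E subrr expr0n gtn_eqF// mul0r mul0e.
apply/eqP; rewrite eq_le outer_measure_ge0 andbT; apply/lee_addgt0Pr => e e0.
rewrite add0e; pose c := fine (h (@chart R k m @^-1` corner 0)).
have c0 : 0 <= c by apply: fine_ge0; exact: outer_measure_ge0.
(* The degenerate corner lies in that of [(1 - r) *: t], whose row [i0] sums to 1 - r and whose mass
   is thus at most r^m c <= r c <= e. The minimum with 1 keeps 1 - r nonnegative. *)
pose r := Num.min 1 (e / (c + 1)).
have r0 : 0 < r by rewrite lt_min ltr01 divr_gt0// ltr_wpDl.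
have r1 : r <= 1 by rewrite ge_min lexx.
pose u := (1 - r) *: t.
have uE i : \sum_j u i j = (1 - r) * \sum_j t i j.
  by rewrite mulr_sumr; apply: eq_bigr => j _; rewrite mxE.
have ru i : r <= 1 - \sum_j u i j.
  rewrite uE; have := le1 i; have : 0 <= 1 - r by rewrite subr_ge0.
  by move=> h1 h2; have := ler_wpM2l h1 h2; lra.
have u0 i : 0 <= \sum_j u i j.
  by rewrite uE mulr_ge0 ?subr_ge0// sumr_ge0.
apply: (@le_trans _ _ (h (@chart R k m @^-1` corner u))).
  apply: le_outer_measure => x Cx i j; apply: le_trans (Cx i j).
  by rewrite mxE ler_piMl// lerBlDr lerDl ltW.
rewrite chart_hausdorff_corner_pos => [|i]; last by have := ru i; lra.
rewrite -(fineK hfin) -/c -EFinM lee_fin.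
apply: (@le_trans _ _ (r * c)); last first.
  apply: (@le_trans _ _ (e / (c + 1) * c)).
    by rewrite ler_wpM2r// ge_min lexx orbT.
  by rewrite mulrAC ler_pdivrMr ?ltr_wpDl// ler_wpM2l ?(ltW e0)// lerDl.
rewrite ler_wpM2r// (bigD1 i0)//= uE ti0E mulr1 opprB addrCA subrr addr0.
have rm : r ^+ m <= r by rewrite -[leRHS]expr1 ler_wiXn2l// ltW.
apply: le_trans rm; rewrite ler_piMr ?exprn_ge0 ?(ltW r0)//.
apply: prodr_ile1 => i _; rewrite exprn_ge0 ?(le_trans (ltW r0))//=.
by rewrite exprn_ile1 ?(le_trans (ltW r0))// gerBl.
Qed.

End chart_corners.

(** The chart measure is restricted to the preimage [K] of the polytope, pushed forward by the chart
    and normalized; corner values then come from [chart_hausdorff_corner]. *)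
Lemma uniform_markov_ex (R : realType) (n : nat) : (0 < n)%N ->
  exists U : probability (borel_mx R n n) R,
  [/\ forall A, measurable A -> U A = uniform_markov A,
      forall t, U (corner t) = (\prod_i flat_tail (row i t))%:E &
      U (@markov_matrices R n) = 1%E].
Proof.
case: n => // m _.
have [mu muE] := borel_restriction_ex (@chart_hausdorff_separated R m.+1 m).
pose K := @chart R m.+1 m @^-1` corner 0.
have mK : measurable (K : set (borel_mx R m.+1 m)) := measurable_chart_corner _.
have [nu nuE] := pushforward_measure_ex (mrestr mu mK) (@measurable_chart R m.+1 m).
(* [dirac point] is the default of [mnormalize] for mass 0 or infinity, both excluded in [UE]. *)
pose U : probability (borel_mx R m.+1 m.+1) R := mnormalize nu (dirac point).
have nuT : nu setT = chart_hausdorff K.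
  by rewrite nuE preimage_setT /= /mrestr setTI muE.
have KE z : markov_matrices z <-> corner 0 z /\ range (@chart R m.+1 m) z.
  rewrite markov_matricesE; split=> -[z0 z1]; split => //.
    by rewrite -(chart_surj z1); exists (\matrix_(i, l) z i (lift ord0 l)).
  by move=> i; case: z1 => x _ <-; exact: chart_sum.
have imK A : @chart R m.+1 m @` (@chart R m.+1 m @^-1` A `&` K) = A `&` @markov_matrices R m.+1.
  apply/seteqP; split=> [_ [x [Ax Kx] <-]|z [Az /KE[z0 [x _ xz]]]].
    by split => //; apply/KE; split=> //; exists x.
  by exists x => //; rewrite /K /= xz.
have UE A : U A = (chart_hausdorff (@chart R m.+1 m @^-1` A `&` K) / chart_hausdorff K)%E.
  rewrite /U/= /mnormalize nuT gt_eqF ?chart_hausdorff_simplex_gt0//=.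
  rewrite lt_eqF ?chart_hausdorff_corner_fin//= nuE /= /mrestr muE; congr (_ * _)%E.
  have Kfin : chart_hausdorff K \is a fin_num.
    by rewrite ge0_fin_numE ?outer_measure_ge0// chart_hausdorff_corner_fin.
  rewrite -[in RHS](fineK Kfin) inver ifF// fine_eq0//.
  by rewrite gt_eqF// chart_hausdorff_simplex_gt0.
have UU A : U A = uniform_markov A.
  have MK : @chart R m.+1 m @` K = @markov_matrices R m.+1.
    by rewrite -[RHS]setTI -imK preimage_setT setTI.
  by rewrite UE /uniform_markov /uniform_on -imK /chart_hausdorff MK.
exists U; split => // [t|].
  (* Entries are nonnegative on [K], so the bounds may be replaced by their positive parts, as the
     corner formula requires. *)
  have -> : U (corner t) = U (corner (\matrix_(i, j) Num.max (t i j) 0)).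
    rewrite !UE; congr (chart_hausdorff _ / _)%E; apply/seteqP.
    split=> x [Cx Kx]; split => // i j; have := Cx i j; have := Kx i j; rewrite !mxE.
      by move=> h1 h2; rewrite ge_max h2.
    by move=> _; rewrite ge_max => /andP[].
  rewrite UE (_ : _ `&` K = @chart R m.+1 m @^-1` corner (\matrix_(i, j) Num.max (t i j) 0)).
    rewrite chart_hausdorff_corner => [|i j]; last by rewrite mxE le_max lexx orbT.
    rewrite -muleA divee ?mule1.
    - congr EFin; apply: eq_bigr => i _; rewrite /flat_tail.
      by under [in LHS]eq_bigr => j _ do rewrite !mxE -maxA maxxx;
        under [in RHS]eq_bigr => j _ do rewrite !mxE.
    - by rewrite ge0_fin_numE ?outer_measure_ge0// chart_hausdorff_corner_fin.
    - by rewrite gt_eqF// chart_hausdorff_simplex_gt0.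
  apply/seteqP; split=> [x []//|x Cx]; split=> // i j.
  by apply: le_trans (Cx i j); rewrite !mxE le_max lexx orbT.
rewrite UU -[RHS](probability_setT U) UU /uniform_markov /uniform_on setTI.
by rewrite setIid.
Qed.

(** * Gamma integrals *)

Section gamma_integrals.
Context (R : realType).
Local Notation leb := (@lebesgue_measure R).

(** This is Gamma(k+1) = k!, a normalizing constant that cancels in [normalized_law]. *)
Definition gamma_mass (k : nat) : \bar R :=
  (\int[leb]_(s in `[0%R, +oo[) (s ^+ k * expR (- s))%:E)%E.

Lemma measurable_gamma (k : nat) (D : set R) :
  measurable_fun D (fun s : R => (s ^+ k * expR (- s))%:E).
Proof.
apply/measurable_EFinP/measurable_funTS; apply: measurable_funM.
  exact: exprn_measurable.
apply: continuous_measurable_fun => x.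
apply: (@continuous_comp _ _ _ -%R expR); first exact: opp_continuous.
exact: continuous_expR.
Qed.

(** Substitution s = x + a. *)
Lemma gamma_mass_shift (k : nat) (a : R) : 0 <= a ->
  (\int[leb]_(s in `[a, +oo[) ((s - a) ^+ k * expR (- s))%:E =
   (expR (- a))%:E * gamma_mass k)%E.
Proof.
move=> a0; pose F (x : R) := x + a; pose G (x : R) := (x - a) ^+ k * expR (- x).
have F1 : derive1 F = cst 1.
  by apply/funext => x; rewrite derive1E /F deriveD// derive_id derive_cst addr0.
have cF x : {for x, continuous F}.
  by apply: cvgD; [exact: cvg_id|exact: cvg_cst].
have cG x : {for x, continuous G}.
  apply: continuousM.
    apply: (@continuous_comp _ _ _ (fun x : R => x - a) (fun x : R => x ^+ k)).
      by apply: cvgB; [exact: cvg_id|exact: cvg_cst].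
    exact: exprn_continuous.
  apply: (@continuous_comp _ _ _ -%R expR); first exact: opp_continuous.
  exact: continuous_expR.
have Fa : F 0 = a by rewrite /F add0r.
transitivity (\int[leb]_(x in `[F 0%R, +oo[) (G x)%:E)%E; first by rewrite Fa.
rewrite (@increasing_ge0_integration_by_substitutiony R F G 0).
- rewrite F1 /gamma_mass -ge0_integralZl//=; last 2 first.
  + exact: measurable_gamma.
  + move=> s; rewrite in_itv/= andbT => s0.
    by rewrite lee_fin mulr_ge0 ?exprn_ge0 ?expR_ge0.
  apply: eq_integral => s _; rewrite /G /F /= -EFinM; congr EFin.
  by rewrite fctE/= mulr1 addrK opprD expRD; ring.
- by move=> x y _ _ xy; rewrite ltrD2r.
- by rewrite F1 => x _; exact: cst_continuous.
- by rewrite F1; exact: is_cvg_cst.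
- by rewrite F1; exact: is_cvg_cst.
- split=> [x _|]; first by apply: derivableD.
  by apply: cvg_at_right_filter; exact: cF.
- by exact: cvg_addrr.
- by apply: continuous_subspaceT => x; exact: cG.
- move=> x; rewrite in_itv/= andbT Fa => /ltW ax.
  by rewrite mulr_ge0 ?expR_ge0// exprn_ge0// subr_ge0.
Qed.

Lemma gamma_mass0 : gamma_mass 0 = 1%E.
Proof.
rewrite -(@integral_exponential_pdf R 1)// /gamma_mass integral_mkcond.
apply: eq_integral => s _; rewrite patchE /exponential_pdf patchE.
by case: ifP; rewrite // expr0 mul1r mulN1r mul1r.
Qed.

(** Below, s^k >= 1 on [1, +oo[ leaves an exponential tail; above, comparison with the exponential
    density of rate 1/2. *)
Lemma gamma_mass_fin (k : nat) : (0 < gamma_mass k < +oo)%E.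
Proof.
have g0 (s : R) : 0 <= s -> (0 <= (s ^+ k * expR (- s))%:E)%E.
  by move=> s0; rewrite lee_fin mulr_ge0 ?exprn_ge0 ?expR_ge0.
apply/andP; split.
  apply: (@lt_le_trans _ _ (\int[leb]_(s in `[1%R, +oo[) ((s - 1) ^+ 0 * expR (- s))%:E)%E).
    by rewrite (gamma_mass_shift 0 ler01) gamma_mass0 mule1 lte_fin expR_gt0.
  apply: (@le_trans _ _ (\int[leb]_(s in `[1%R, +oo[) (s ^+ k * expR (- s))%:E)%E).
    apply: ge0_le_integral => //=.
    - by move=> s _; rewrite lee_fin expr0 mul1r expR_ge0.
    - exact: (measurable_gamma 0).
    - exact: measurable_gamma.
    - move=> s; rewrite in_itv/= andbT => s1.
      by rewrite lee_fin expr0 ler_wpM2r ?expR_ge0// exprn_ege1.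
  apply: ge0_subset_integral => //=; first exact: measurable_gamma.
    by move=> s; rewrite in_itv/= andbT; exact: g0.
  by move=> s /=; rewrite !in_itv/= !andbT; exact: le_trans.
(* From one term of the exponential series at s/2, s^k <= 2^k k! exp(s/2); the last factor 2 cancels
   the rate 1/2 of the density. *)
pose c : R := 2 ^+ k * k`!%:R * 2.
have c0 : 0 <= c by rewrite !mulr_ge0 ?exprn_ge0.
have half0 : 0 < 2^-1 :> R by rewrite invr_gt0.
apply: (@le_lt_trans _ _ (\int[leb]_(s in `[0%R, +oo[) (c * exponential_pdf 2^-1 s)%:E)%E).
  apply: ge0_le_integral => //=.
  - by move=> s; rewrite in_itv/= andbT; exact: g0.
  - exact: measurable_gamma.
  - apply/measurable_EFinP/measurable_funTS; apply: measurable_funM => //.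
    exact: measurable_exponential_pdf.
  - move=> s; rewrite in_itv/= andbT => s0.
    rewrite lee_fin exponential_pdfE// /c mulrA mulfK ?gt_eqF//.
    rewrite [X in expR (- X)](splitr s) opprD expRD mulrA.
    rewrite (_ : - 2^-1 * s = - (s / 2)); last by ring.
    rewrite ler_wpM2r ?expR_ge0// expRN ler_pdivrMr ?expR_gt0//.
    have -> : s ^+ k = 2 ^+ k * (s / 2) ^+ k by rewrite -exprMn mulrC divfK.
    rewrite -mulrA ler_wpM2l ?exprn_ge0//.
    case: (k) => [|k']; first by rewrite expr0 mul1r -expR0 ler_expR divr_ge0.
    have h := @expR_ge1Dxn R (s / 2) k' (divr_ge0 s0 (ler0n R 2)).
    rewrite [leRHS]mulrC -ler_pdivrMr ?ltr0n ?fact_gt0//.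
    by apply: le_trans h; rewrite lerDr.
apply: (@le_lt_trans _ _ (\int[leb]_s (c * exponential_pdf 2^-1 s)%:E)%E).
  apply: ge0_subset_integral => //=.
    apply/measurable_EFinP; apply: measurable_funM => //.
    exact: measurable_exponential_pdf.
  by move=> s _; rewrite lee_fin mulr_ge0// exponential_pdf_ge0// ltW.
under eq_integral do rewrite EFinM.
rewrite ge0_integralZl//=.
- by rewrite integral_exponential_pdf// mule1 ltry.
- by apply/measurable_EFinP; exact: measurable_exponential_pdf.
- by move=> s _; rewrite lee_fin exponential_pdf_ge0// ltW.
Qed.

Lemma exponential_tail (a : R) :
  exponential_prob 1 `[a, +oo[%classic = (expR (- Num.max a 0))%:E.
Proof.
have b0 : 0 <= Num.max a 0 by rewrite le_max lexx orbT.
rewrite -[RHS]mule1 -gamma_mass0 -(gamma_mass_shift 0 b0).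
have -> : `[Num.max a 0, +oo[%classic = `[a, +oo[%classic `&` `[0, +oo[%classic.
  apply/seteqP; split=> x /=; rewrite !in_itv/= !andbT ge_max.
    by move=> /andP[].
  by move=> [-> ->].
rewrite integral_mkcondr /exponential_prob; apply: eq_integral => s _.
by rewrite /exponential_pdf !patchE; case: ifP; rewrite // expr0 mul1r mulN1r mul1r.
Qed.

Lemma Gamma1 : Gamma 1 = 1 :> R.
Proof.
rewrite /Gamma /Rintegral.
have -> : (\int[leb]_(t in `]0%R, +oo[) (t `^ (1 - 1) * expR (- t))%:E = 1)%E.
  rewrite -gamma_mass0 /gamma_mass -integral_itv_obnd_cbnd; last exact: measurable_gamma.
  by apply: eq_integral => t _; rewrite subrr powRr0 expr0.
by [].
Qed.

(** The two densities differ only at 0, a null set. *)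
Lemma gamma_density1 (B : set R) : measurable B ->
  (\int[leb]_(t in B) (gamma_density 1 t)%:E = exponential_prob 1 B)%E.
Proof.
move=> mB.
have E (t : R) : t != 0 -> gamma_density 1 t = exponential_pdf 1 t.
  move=> t0; rewrite /gamma_density /exponential_pdf patchE Gamma1 invr1 subrr powRr0 !mul1r.
  rewrite mulN1r mem_setE in_itv/= andbT le_eqVlt eq_sym (negbTE t0)/=.
  by case: ifP.
have mpdf : measurable_fun (B `\ 0) (fun t : R => (exponential_pdf 1 t)%:E).
  apply/measurable_EFinP/measurable_funTS; exact: measurable_exponential_pdf.
have mBD : measurable (B `\ (0 : R)) by exact: measurableD.
rewrite /exponential_prob -(@integral_setD1 _ _ 0)//.
  rewrite -[in RHS](@integral_setD1 _ _ 0)//; apply: eq_integral => t.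
  by rewrite inE => -[_ /eqP t0]; rewrite E.
apply: eq_measurable_fun mpdf => t; rewrite inE => -[_ /eqP t0].
by rewrite E.
Qed.

End gamma_integrals.

(** * The flat Dirichlet distribution *)

Lemma measurable_inv (R : realType) : measurable_fun setT (@GRing.inv R).
Proof.
rewrite -(setvU [set (0 : R)]); apply/measurable_funU => //; first exact: measurableC.
split; last exact: measurable_fun_set1.
apply: open_continuous_measurable_fun; first exact: closed_openC.
by move=> x; rewrite inE => /eqP; exact: inv_continuous.
Qed.

Lemma prob1_setI d (T : measurableType d) (R : realType) (P : probability T R)
    (S A : set T) : measurable S -> P S = 1%E -> measurable A -> P (A `&` S) = P A.
Proof.
move=> mS PS mA.
have PC0 : P (A `&` ~` S) = 0%E.
  apply/eqP; rewrite eq_le measure_ge0 andbT.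
  apply: (@le_trans _ _ (P (~` S))); last by rewrite probability_setC// PS subee.
  by apply: le_measure; rewrite ?inE//; [apply: measurableI => //|]; exact: measurableC.
have -> : P A = (P (A `&` S) + P (A `&` ~` S))%E.
  rewrite -measureU ?[in RHS]setIA -?setIUr ?setUv ?setIT//.
  - exact: measurableI.
  - by apply: measurableI => //; exact: measurableC.
  - by rewrite setIACA setICr setI0.
by rewrite PC0 adde0.
Qed.

Lemma flat_tail0 (R : realType) n : flat_tail (0 : 'rV[R]_n) = 1.
Proof.
rewrite /flat_tail big1 => [|j _]; last by rewrite mxE maxxx.
by rewrite ler01 subr0 expr1n.
Qed.

Lemma measurable_simplex (R : realType) (n : nat) :
  measurable (@simplex R n : set (borel_mx R 1 n)).
Proof.
rewrite (_ : simplex (n:=n) = [set x : 'rV[R]_n | forall i j, x i j \in `[0, 1]] `&`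
    (fun x : borel_mx R 1 n => \sum_j (x : 'rV[R]_n) ord0 j) @^-1` [set 1]); last first.
  apply/seteqP; split=> x [H1 H2]; split=> //.
    by move=> i j; rewrite ord1 in_itv/= H1.
  by move=> j; have := H1 ord0 j; rewrite in_itv.
apply: measurableI.
  by apply: (@measurable_entrywise _ _ _ _ (fun _ _ => `[0, 1]%classic)).
rewrite -[X in measurable X]setTI.
by apply: measurable_sum => // j; exact: measurable_coord.
Qed.

(** [D] is the law of the first row under the uniform distribution [U] on the Markov matrices. *)
Lemma flat_dirichlet_ex (R : realType) (n : nat) : (0 < n)%N ->
  exists D : probability (borel_mx R 1 n) R,
    (forall t, D (corner t) = (flat_tail t)%:E) /\ D (@simplex R n) = 1%E.
Proof.
case: n => // m _; have [U [_ UC U1]] := @uniform_markov_ex R m.+1 isT.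
pose X : {RV U >-> borel_mx R 1 m.+1} :=
  mfun_Sub (mem_set (@measurable_row R m.+1 m.+1 ord0)).
have mS := @measurable_simplex R m.+1.
pose K : set (borel_mx R m.+1 m.+1) := \bigcap_(i in setT) (row i @^-1` @simplex R m.+1).
have mX i : measurable (row i @^-1` @simplex R m.+1 : set (borel_mx R m.+1 m.+1)).
  by rewrite -[X in measurable X]setTI; exact: measurable_row.
have mK : measurable K by apply: fin_bigcap_measurable.
have KE : K = @markov_matrices R m.+1.
  by apply/seteqP; split=> z Kz i; [exact: Kz|move=> _; exact: Kz].
exists (distribution U X); split=> [t|]; last first.
  apply/eqP; rewrite eq_le probability_le1//= -U1 -KE.
  by apply: le_measure; rewrite ?inE//; [exact: mX|move=> z Kz; exact: (Kz ord0)].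
(* Zero bounds on the other rows hold on every Markov matrix and contribute the factor
   [flat_tail 0 = 1]. *)
pose T : 'M[R]_m.+1 := \matrix_(i, j) if i == ord0 then t ord0 j else 0.
have mC : measurable (row ord0 @^-1` corner t : set (borel_mx R m.+1 m.+1)).
  by rewrite -[X in measurable X]setTI; apply: measurable_row => //; exact: measurable_corner.
have -> : flat_tail t = \prod_i flat_tail (row i T).
  rewrite (bigD1 ord0)//= big1 => [|i i0]; last first.
    rewrite (_ : row i T = 0) ?flat_tail0//; apply/rowP => j.
    by rewrite !mxE (negbTE i0).
  by rewrite mulr1; congr flat_tail; apply/rowP => j; rewrite !mxE.
rewrite -UC -(prob1_setI mK _ (measurable_corner T)) ?KE//.
change (U (row ord0 @^-1` corner t) = U (corner T `&` @markov_matrices R m.+1)).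
rewrite -(prob1_setI mK _ mC) ?KE//.
congr (U _); apply/seteqP; split=> z [Cz Kz]; split=> //.
  move=> i j; rewrite mxE; case: eqP => [->|_].
    by have := Cz ord0 j; rewrite /= mxE.
  by have [z0 _] := markov_matricesE z; have [/(_ i j)] := z0 Kz; rewrite mxE.
by move=> i j; have := Cz ord0 j; rewrite !mxE eqxx (ord1 i).
Qed.

Lemma measurable_dilation (R : realType) (n : nat) (s : R) (A : set (borel_mx R 1 n)) :
  measurable A ->
  measurable ([set x : 'rV[R]_n | A (s *: x)] : set (borel_mx R 1 n)).
Proof.
move=> mA; rewrite -[X in measurable X]setTI.
have : measurable_fun setT (fun x : borel_mx R 1 n => s *: (x : 'rV[R]_n) : borel_mx R 1 n).
  apply: measurable_mx => i j; under eq_fun do rewrite mxE.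
  by apply: measurable_funM => //; exact: measurable_coord.
by move=> /(_ measurableT A mA).
Qed.

Section gamma_mixture.
Context (R : realType) (n : nat) (D : probability (borel_mx R 1 n) R).
Local Notation leb := (@lebesgue_measure R).
Local Open Scope ereal_scope.

(* The law of [s *: x], up to a constant, for [s] with the Gamma density of
   parameter [n] and [x] independent with law [D]. *)
Definition gamma_mixture (A : set (borel_mx R 1 n)) : \bar R :=
  \int[leb]_(s in `]0%R, +oo[)
    ((s ^+ n.-1 * expR (- s))%:E * D [set x : 'rV[R]_n | A (s *: x)]).

Let gamma_ge0 (s : R) : (s \in `]0%R, +oo[)%R -> 0 <= (s ^+ n.-1 * expR (- s))%:E.
Proof.
rewrite in_itv/= andbT => /ltW s0.
by rewrite lee_fin mulr_ge0 ?exprn_ge0 ?expR_ge0.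
Qed.

Let measurable_scale :
  measurable_fun setT (fun p : R * borel_mx R 1 n => p.1 *: (p.2 : 'rV[R]_n) : borel_mx R 1 n).
Proof.
apply: measurable_mx => i j; under eq_fun do rewrite mxE.
apply: measurable_funM; first exact: measurable_fst.
exact: measurableT_comp (@measurable_coord R 1 n i j) measurable_snd.
Qed.

Let measurable_integrand (A : set (borel_mx R 1 n)) E : measurable A ->
  measurable_fun E (fun s : R =>
    (s ^+ n.-1 * expR (- s))%:E * D [set x : 'rV[R]_n | A (s *: x)]).
Proof.
move=> mA; apply: emeasurable_funM; first exact: measurable_gamma.
apply: measurable_funTS.
have mA' : measurable ((fun p : R * borel_mx R 1 n =>
    p.1 *: (p.2 : 'rV[R]_n) : borel_mx R 1 n) @^-1` A).
  by rewrite -[X in measurable X]setTI; exact: measurable_scale.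
have := measurable_fun_xsection D mA'; apply: eq_measurable_fun => s _ /=.
by congr (D _); apply/seteqP; split=> x /=; rewrite /xsection/= inE.
Qed.

Let gamma_mixture0 : gamma_mixture set0 = 0.
Proof.
rewrite /gamma_mixture integral0_eq// => s _.
by rewrite (_ : [set _ | _] = set0) ?measure0 ?mule0//; apply/seteqP; split.
Qed.

Let gamma_mixture_ge0 A : 0 <= gamma_mixture A.
Proof.
by apply: integral_ge0 => s /= s0; rewrite mule_ge0 ?gamma_ge0.
Qed.

Let gamma_mixture_sigma_additive : semi_sigma_additive gamma_mixture.
Proof.
move=> F mF tF mUF.
rewrite [X in _ --> X](_ : _ = \sum_(0 <= i <oo) gamma_mixture (F i)).
  by apply: is_cvg_nneseries => i _ _; exact: gamma_mixture_ge0.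
rewrite /gamma_mixture -integral_nneseries//=.
- apply: eq_integral => s; rewrite inE/= => s0.
  rewrite (_ : [set x | _] = \bigcup_i [set x : 'rV[R]_n | F i (s *: x)]).
    rewrite measure_semi_bigcup.
    + by rewrite nneseriesZl// => i _; exact: measure_ge0.
    + by move=> i; exact: measurable_dilation.
    + apply/trivIsetP => i j _ _ ij; apply/seteqP; split=> // x [/= Fi Fj].
      have : (F i `&` F j) (s *: x) by [].
      by move/trivIsetP : tF => /(_ i j Logic.I Logic.I ij) ->.
    + apply: bigcupT_measurable => i; exact: measurable_dilation.
  by apply/seteqP; split=> x [i _ Fi]; exists i.
- by move=> i; exact: measurable_integrand.
- by move=> i s s0; rewrite mule_ge0 ?gamma_ge0.
Qed.

HB.instance Definition _ := isMeasure.Build _ _ _ gamma_mixture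
  gamma_mixture0 gamma_mixture_ge0 gamma_mixture_sigma_additive.

(** Meant for preimages under [normalize], where the dilation factor [s] has no influence on the
    mass. *)
Lemma gamma_mixture_cst (A : set (borel_mx R 1 n)) (p : \bar R) : 0 <= p ->
  (forall s : R, (0 < s)%R -> D [set x : 'rV[R]_n | A (s *: x)] = p) ->
  gamma_mixture A = p * gamma_mass R n.-1.
Proof.
move=> p0 DA; rewrite /gamma_mixture /gamma_mass.
rewrite -integral_itv_obnd_cbnd; last exact: measurable_gamma.
rewrite [RHS]muleC -ge0_integralZr//=.
- apply: eq_integral => s; rewrite inE/= in_itv/= andbT => s0.
  by rewrite DA.
- exact: measurable_gamma.
Qed.

(** Dividing the corner by s gives the tail (1 - A/s)^(n-1); multiplied by s^(n-1) it becomes (s -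
    A)^(n-1) on s >= A, a shifted Gamma integral. *)
Lemma gamma_mixture_corner (a : 'rV[R]_n) :
  (forall t, D (corner t) = (flat_tail t)%:E) ->
  gamma_mixture (corner a) =
  (expR (- \sum_j Num.max (a ord0 j) 0))%R%:E * gamma_mass R n.-1.
Proof.
move=> DC; set A : R := (\sum_j _)%R.
have A0 : (0 <= A)%R by apply: sumr_ge0 => j _; rewrite le_max lexx orbT.
rewrite -gamma_mass_shift// /gamma_mixture.
pose f (s : R) := ((s - A) ^+ n.-1 * expR (- s))%R.
transitivity (\int[leb]_(s in `]0%R, +oo[) ((EFin \o f) \_ `[A, +oo[) s).
  apply: eq_integral => s; rewrite inE/= in_itv/= andbT => s0.
  rewrite (_ : [set x | _] = corner (s^-1 *: a)); last first.
    apply/seteqP.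
    by split=> x Cx i j; have := Cx i j; rewrite !mxE ler_pdivrMl.
  rewrite DC /flat_tail (_ : (\sum_j _)%R = (s^-1 * A)%R); last first.
    rewrite mulr_sumr; apply: eq_bigr => j _.
    by rewrite mxE maxr_pMr ?mulr0// invr_ge0 ltW.
  rewrite patchE mem_setE in_itv/= andbT ler_pdivrMl// mulr1.
  case: ifPn => [As|_]; last by rewrite mule0.
  rewrite -EFinM /f/=; congr EFin; rewrite mulrAC -exprMn mulrBr mulr1.
  by rewrite mulVKf// gt_eqF.
have mf D' : measurable_fun D' ((EFin \o f) \_ `[A, +oo[ : R -> \bar R).
  apply: measurable_funTS.
  apply: (iffLR (measurable_restrictT (D := `[A, +oo[%classic) (EFin \o f) _)) => //.
  apply/measurable_EFinP/measurable_funTS; apply: measurable_funM.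
    by apply: measurable_funX; apply: measurable_funB.
  exact: measurableT_comp.
rewrite integral_itv_obnd_cbnd// -integral_mkcondr.
congr (integral _ _ _); apply/seteqP; split=> s /=; rewrite !in_itv/= !andbT.
  by move=> [].
by move=> As; split=> //; exact: le_trans As.
Qed.

End gamma_mixture.

Section dirichlet.
Context (R : realType) (n : nat).

Definition row_of d (T : measurableType d) (P : probability T R)
    (G : 'I_n -> {RV P >-> R}) (w : T) : borel_mx R 1 n := \row_i G i w.

Lemma measurable_row_of d (T : measurableType d) (P : probability T R)
  (G : 'I_n -> {RV P >-> R}) : measurable_fun setT (row_of G).
Proof.
apply: measurable_mx => i j; rewrite /row_of.
by under eq_fun do rewrite mxE; exact: measurable_funPT.
Qed.

Lemma exponential_corner d (T : measurableType d) (P : probability T R)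
    (G : 'I_n -> {RV P >-> R}) (a : 'rV[R]_n) :
  independent_RVs G -> (forall i, gamma_law 1 (distribution P (G i))) ->
  P [set w | corner a (row_of G w)] = (expR (- \sum_j Num.max (a ord0 j) 0))%:E.
Proof.
move=> /independent_RVsP indG lawG.
have := indG (fun i => `[a ord0 i, +oo[%classic) (fun i => measurable_itv _).
rewrite (_ : [set w | _] = [set w | corner a (row_of G w)]).
  move=> ->; rewrite -sumrN expR_sum -prodEFin; apply: eq_bigr => i _.
  rewrite -[LHS]/(distribution P (G i) _) lawG// gamma_density1//.
  exact: exponential_tail.
apply/seteqP; split=> w /= H.
  by move=> i j; rewrite ord1 mxE; have := H j; rewrite in_itv/= andbT.
by move=> j; have := H ord0 j; rewrite mxE in_itv/= andbT.
Qed.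

Definition normalize (y : borel_mx R 1 n) : borel_mx R 1 n :=
  \row_i ((y : 'rV[R]_n) ord0 i / \sum_k (y : 'rV[R]_n) ord0 k).

Lemma measurable_normalize : measurable_fun setT normalize.
Proof.
apply: measurable_mx => i j; rewrite /normalize.
under eq_fun do rewrite mxE.
apply: measurable_funM; first exact: measurable_coord.
apply: (measurableT_comp (@measurable_inv R)).
by apply: measurable_sum => k; exact: measurable_coord.
Qed.

Lemma normalize_row_of d (T : measurableType d) (P : probability T R)
    (G : 'I_n -> {RV P >-> R}) w :
  normalize (row_of G w) = \row_i (G i w / \sum_k G k w).
Proof.
apply/rowP => i; rewrite !mxE; congr (_ / _).
by apply: eq_bigr => k _; rewrite mxE.
Qed.

Context (D : probability (borel_mx R 1 n) R).
Hypothesis D_corner : forall t, D (corner t) = (flat_tail t)%:E.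
Hypothesis D_simplex : D (@simplex R n) = 1%E.

(* If [x] has law [D] and [s] is independent of [x] with the Gamma density of
   parameter [n], then [s *: x] has independent exponential coordinates. *)
Lemma normalized_law d (T : measurableType d) (P : probability T R)
    (G : 'I_n -> {RV P >-> R}) (B : set (borel_mx R 1 n)) :
  independent_RVs G -> (forall i, gamma_law 1 (distribution P (G i))) ->
  measurable B -> P [set w | B (normalize (row_of G w))] = D B.
Proof.
move=> indG lawG mB.
have /andP[m0 moo] := gamma_mass_fin R n.-1.
have mfin : gamma_mass R n.-1 \is a fin_num by rewrite ge0_fin_numE// ltW.
have [nu nuE] := pushforward_measure_ex P (@measurable_row_of _ _ P G).
have c0 : 0 <= fine (gamma_mass R n.-1) by rewrite fine_ge0// ltW.
(* The factor matches the mixture, which is left unnormalized; the two measures are compared on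
   corners. *)
pose m1 : {measure set _ -> \bar R} := mscale (NngNum c0) nu.
have m1E A : m1 A = (gamma_mass R n.-1 * P [set w | A (row_of G w)])%E.
  by rewrite /m1/= /mscale/= fineK// nuE.
have eqm A : measurable A -> m1 A = gamma_mixture D A.
  apply: corner_unique => [|t].
    by rewrite m1E (_ : [set _ | _] = setT) ?probability_setT ?mule1.
  by rewrite m1E exponential_corner// muleC; exact/esym/gamma_mixture_corner.
have mNB : measurable (normalize @^-1` B).
  by rewrite -[X in measurable X]setTI; exact: measurable_normalize.
have mS := @measurable_simplex R n.
(* [D] is carried by the simplex, and there [normalize] undoes the dilation, so each s contributes
   the mass [D B]. *)
have main : gamma_mixture D (normalize @^-1` B) = (D B * gamma_mass R n.-1)%E.
  apply: gamma_mixture_cst => // s s0.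
  have mNsB := measurable_dilation s mNB.
  rewrite -(prob1_setI mS D_simplex mB) -(prob1_setI mS D_simplex mNsB).
  have norm_scale x : simplex x -> normalize (s *: x) = x.
    move=> [_ x1]; apply/rowP => j; rewrite !mxE.
    under eq_bigr do rewrite mxE.
    by rewrite -mulr_sumr x1 mulr1 mulrAC divff ?mul1r// gt_eqF.
  by congr (D _); apply/seteqP; split=> x [/= Bx Sx]; rewrite norm_scale in Bx *.
have := eqm _ mNB; rewrite m1E main muleC -(fineK mfin) => eqP.
have c_neq0 : fine (gamma_mass R n.-1) != 0.
  by rewrite fine_eq0// gt_eqF.
rewrite -[LHS]mule1 -[RHS]mule1 -(divff c_neq0) EFinM !muleA; congr (_ * _)%E.
exact: eqP.
Qed.

(** One direction is [normalized_law]; the other exhibits independent exponential variables,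
    provided by [iid_ex]. *)
Lemma dirichlet_flatP (mu : set (borel_mx R 1 n) -> \bar R) :
  dirichlet_law (fun=> 1%:pos) mu <-> forall B, measurable B -> mu B = D B.
Proof.
split=> [[d [T [P [G [indG lawG muE]]]]] B mB|muD].
  rewrite muE// -(normalized_law indG lawG mB); congr (P _).
  by apply/seteqP; split=> w /=; rewrite normalize_row_of.
pose expo :=
  exponential_distribution_exponential_prob__canonical__probability_measure_Probability (@ltr01 R).
have mid : @measurable_fun _ _ (measurableTypeR R) (R : measurableType _) setT idfun.
  exact: measurable_id.
pose X : {RV expo >-> R} := @mfun_Sub _ _ _ (R : measurableType _) _ (mem_set mid).
have [d [T [P [G [indG lawG]]]]] := iid_ex (distribution expo X) n.
exists d, T, P, G; split=> // [i A mA|B mB].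
  by rewrite lawG// gamma_density1.
rewrite muD// -(normalized_law indG _ mB).
  by congr (P _); apply/seteqP; split=> w /=; rewrite normalize_row_of.
by move=> i A mA; rewrite lawG// gamma_density1.
Qed.

End dirichlet.

(** * Permutations and means *)

(** The preimage under [f] is the image under the inverse isometry [g], and invariance of [K] lets
    the intersection with [K] pass through. *)
Lemma uniform_on_isometry (R : realType) (m n d : nat) (f g : 'M[R]_(m, n) -> 'M[R]_(m, n))
    (K A : set 'M[R]_(m, n)) :
  (forall x y, eucl_dist (f x) (f y) = eucl_dist x y) -> cancel f g -> cancel g f ->
  f @^-1` K = K -> uniform_on d K (f @^-1` A) = uniform_on d K A.
Proof.
move=> fiso fg gf fK; rewrite /uniform_on; congr (_ / _)%E.
rewrite -[in LHS]fK -preimage_setI.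
have giso x y : eucl_dist (g x) (g y) = eucl_dist x y by rewrite -fiso !gf.
rewrite -(hausdorff_isometry d (A `&` K) giso gf fg); congr (hausdorff _ _).
apply/seteqP; split=> [x AKx|_ [x AKx <-]]; last by rewrite /preimage/= gf.
by exists (f x).
Qed.

Lemma uniform_markov_row_perm (R : realType) (n : nat) (s : 'S_n) (A : set 'M[R]_n) :
  uniform_markov (row_perm s @^-1` A) = uniform_markov A.
Proof.
have rowKV (t : 'S_n) : cancel (@row_perm R n n t) (row_perm t^-1).
  by move=> x; rewrite -row_permM mulVg row_perm1.
have markov_row_perm (t : 'S_n) (x : 'M[R]_n) :
    markov_matrices x -> markov_matrices (row_perm t x).
  move=> Kx i; rewrite (_ : row i _ = row (t i) x); first exact: Kx.
  by apply/rowP => j; rewrite !mxE.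
apply: (@uniform_on_isometry _ _ _ _ _ (row_perm s^-1)).
- move=> x y; congr Num.sqrt; rewrite [RHS](reindex_inj (@perm_inj _ s))/=.
  by apply: eq_bigr => i _; apply: eq_bigr => j _; rewrite !mxE.
- exact: rowKV.
- by move=> x; have := rowKV s^-1%g x; rewrite invgK.
- apply/seteqP; split=> x /=; last exact: markov_row_perm.
  by move/(markov_row_perm s^-1%g); rewrite rowKV.
Qed.

Lemma uniform_markov_col_perm (R : realType) (n : nat) (s : 'S_n) (A : set 'M[R]_n) :
  uniform_markov (col_perm s @^-1` A) = uniform_markov A.
Proof.
have colKV (t : 'S_n) : cancel (@col_perm R n n t) (col_perm t^-1).
  by move=> x; rewrite -col_permM mulVg col_perm1.
have markov_col_perm (t : 'S_n) (x : 'M[R]_n) :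
    markov_matrices x -> markov_matrices (col_perm t x).
  move=> Kx i; have [x01 x1] := Kx i; split=> [j|].
    by have := x01 (t j); rewrite !mxE.
  rewrite -x1 [RHS](reindex_inj (@perm_inj _ t))/=.
  by apply: eq_bigr => j _; rewrite !mxE.
apply: (@uniform_on_isometry _ _ _ _ _ (col_perm s^-1)).
- move=> x y; congr Num.sqrt; apply: eq_bigr => i _.
  rewrite [RHS](reindex_inj (@perm_inj _ s))/=.
  by apply: eq_bigr => j _; rewrite !mxE.
- exact: colKV.
- by move=> x; have := colKV s^-1%g x; rewrite invgK.
- apply/seteqP; split=> x /=; last exact: markov_col_perm.
  by move/(markov_col_perm s^-1%g); rewrite colKV.
Qed.

Section flat_dirichlet_mean.
Context (R : realType) (n : nat) (D : probability (borel_mx R 1 n) R).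
Hypothesis n_gt0 : (0 < n)%N.
Hypothesis D_corner : forall t, D (corner t) = (flat_tail t)%:E.
Hypothesis D_simplex : D (@simplex R n) = 1%E.

(** Positive parts keep the integrands nonnegative, so sums and pushforwards pass through the
    integral; on the simplex they are the coordinates. *)
Let coord_pos (j : 'I_n) (x : borel_mx R 1 n) : \bar R :=
  (Num.max ((x : 'rV[R]_n) ord0 j) 0)%:E.

Let measurable_coord_pos j : measurable_fun setT (coord_pos j).
Proof.
by apply/measurable_EFinP; apply: measurable_funrpos; exact: measurable_coord.
Qed.

Let coord_pos_ge0 j x : (0 <= coord_pos j x)%E.
Proof. by rewrite lee_fin le_max lexx orbT. Qed.

Let D_ae (Q : borel_mx R 1 n -> Prop) :
  (forall x, simplex (x : 'rV[R]_n) -> Q x) -> {ae D, forall x, Q x}.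
Proof.
move=> SQ; exists (~` @simplex R n); split.
- by apply: measurableC; exact: measurable_simplex.
- by rewrite probability_setC ?D_simplex ?subee//; exact: measurable_simplex.
- by move=> x /= nQ Sx; apply: nQ; exact: SQ.
Qed.

(** [flat_tail] is symmetric in its entries, so [D] is invariant under the transposition of [j] and
    [k]. *)
Let integral_coord_pos_sym (j k : 'I_n) :
  (\int[D]_x coord_pos j x = \int[D]_x coord_pos k x)%E.
Proof.
pose f (x : borel_mx R 1 n) : borel_mx R 1 n := col_perm (tperm j k) (x : 'rV[R]_n).
have mf : measurable_fun setT f.
  apply: measurable_mx => i l; rewrite /f; under eq_fun do rewrite mxE.
  exact: measurable_coord.
have [nu nuE] := pushforward_measure_ex D mf.
have nuD A : measurable A -> nu A = D A.
  apply: corner_unique => [|t].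
    by rewrite nuE preimage_setT; apply: le_lt_trans (probability_le1 _ _) (ltry _).
  rewrite nuE (_ : f @^-1` corner t = corner (col_perm (tperm j k) t)).
    apply: etrans (D_corner _) (etrans _ (esym (D_corner t))).
    congr EFin; rewrite /flat_tail.
    rewrite [in RHS](reindex_inj (@perm_inj _ (tperm j k)))/=.
    by under eq_bigr do rewrite mxE.
  apply/seteqP; split=> x Cx i l.
    by have := Cx i (tperm j k l); rewrite /f !mxE tpermK.
  by have := Cx i (tperm j k l); rewrite /f !mxE tpermK.
transitivity (\int[nu]_x coord_pos j x)%E.
  by apply: eq_measure_integral => A mA _; rewrite nuD.
transitivity (\int[pushforward D f]_x coord_pos j x)%E.
  by apply: eq_measure_integral => A mA _; rewrite nuE.
rewrite ge0_integral_pushforward//=.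
by apply: eq_integral => x _; rewrite /coord_pos /f /= mxE tpermL.
Qed.

(** The n coordinates have equal means by symmetry, and they sum to 1 almost surely. *)
Lemma flat_dirichlet_mean (j : 'I_n) :
  (\int[D]_x ((x : 'rV[R]_n) ord0 j)%:E = (n%:R^-1)%:E)%E.
Proof.
transitivity (\int[D]_x coord_pos j x)%E.
  apply: ae_eq_integral => //.
  - by apply/measurable_EFinP; exact: measurable_coord.
  - apply: D_ae => x [x01 _] _; rewrite /coord_pos max_l//.
    by have /andP[] := x01 j.
have sum1 : (\sum_(k < n) \int[D]_x coord_pos k x = 1)%E.
  rewrite -ge0_integral_sum//.
  transitivity (\int[D]_x (cst 1%E x))%E.
    apply: ae_eq_integral => //.
    - exact: emeasurable_sum.
    - apply: D_ae => x [x01 x1] _; rewrite sumEFin; congr EFin.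
      rewrite -[RHS]x1; apply: eq_bigr => k _; rewrite max_l//.
      by have /andP[] := x01 k.
  by rewrite integral_cst// mul1e; exact: probability_setT.
set e := (\int[D]_x _)%E.
have n0 : n%:R != 0 :> R by rewrite pnatr_eq0 -lt0n.
have efin : e \is a fin_num.
  rewrite ge0_fin_numE ?integral_ge0//; apply: (@le_lt_trans _ _ 1%E); last exact: ltry.
  rewrite -sum1 (bigD1 j)//= leeDl// sume_ge0// => k _.
  exact: integral_ge0.
have : (\sum_(k < n) (fine e)%:E = 1%:E)%E.
  by rewrite -sum1; apply: eq_bigr => k _; rewrite fineK//; exact: integral_coord_pos_sym.
rewrite sumEFin => -[]; rewrite sumr_const card_ord -(mulr_natl (fine e)) => ne1.
rewrite -(fineK efin); congr EFin; apply: (mulfI n0).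
by rewrite ne1 divff.
Qed.

End flat_dirichlet_mean.

(** * Random matrices with i.i.d. rows, and the equivalence *)

Lemma iid_rows_ex (R : realType) (m n : nat) (D : probability (borel_mx R 1 n) R) :
  exists d (T : measurableType d) (P : probability T R) (M : {RV P >-> borel_mx R m n}),
    forall B : 'I_m -> set (borel_mx R 1 n), (forall i, measurable (B i)) ->
      P [set w | forall i, B i (row i (M w : 'M[R]_(m, n)))] = (\prod_i D (B i))%E.
Proof.
have [d [T [P [Y [/independent_RVsP indY lawY]]]]] := iid_ex D m.
pose M0 (w : T) : borel_mx R m n := \matrix_(i, j) (Y i w : 'rV[R]_n) ord0 j.
have mM0 : measurable_fun setT M0.
  apply: measurable_mx => i j; rewrite /M0; under eq_fun do rewrite mxE.
  exact: measurableT_comp (@measurable_coord R 1 n ord0 j) (measurable_funPT (Y i)).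
pose M : {RV P >-> borel_mx R m n} := mfun_Sub (mem_set mM0).
exists d, T, P, M => B mB.
have rowM i w : row i (M w : 'M[R]_(m, n)) = Y i w.
  by apply/rowP => j; rewrite !mxE.
rewrite [LHS](_ : _ = P [set w | forall i, B i (Y i w)]).
  by rewrite indY//; apply: eq_bigr => i _; exact: lawY.
by congr (P _); apply/seteqP; split=> w /= H i; have := H i; rewrite rowM.
Qed.

Lemma corner_rows (R : realType) (m n : nat) (t x : 'M[R]_(m, n)) :
  corner t x <-> forall i, corner (row i t) (row i x).
Proof.
split=> [C i k j|C i j]; first by rewrite !mxE; exact: C.
by have := C i ord0 j; rewrite !mxE.
Qed.

Theorem theorem1p1 (R : realType) (n : nat) (n_ge1 : (1 <= n)%N) :
  [/\ forall (d : measure_display) (T : measurableType d) (P : probability T R)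
        (M : {RV P >-> borel_mx R n n}), (forall w, markov_matrices (M w)) ->
        (forall A : set (borel_mx R n n), measurable A ->
           distribution P M A = uniform_markov A) <->
        (iid_RVs (random_row M) /\
         forall i, dirichlet_law (fun=> 1%:pos) (distribution P (random_row M i))),
      forall (d : measure_display) (T : measurableType d) (P : probability T R)
        (X : {RV P >-> borel_mx R 1 n}),
        dirichlet_law (fun=> 1%:pos) (distribution P X) ->
        forall j : 'I_n, 'E_P[fun w => (X w : 'rV[R]_n) ord0 j]%E = (n%:R^-1)%:E,
      forall (s : 'S_n) (A : set (borel_mx R n n)), measurable A ->
        uniform_markov (row_perm s @^-1` A) = uniform_markov A &
      forall (s : 'S_n) (A : set (borel_mx R n n)), measurable A ->
        uniform_markov (col_perm s @^-1` A) = uniform_markov A].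
Proof.
have [D [D_corner D_simplex]] := @flat_dirichlet_ex R n n_ge1.
have [U [U_uniform U_corner _]] := @uniform_markov_ex R n n_ge1.
have dirP := dirichlet_flatP D_corner D_simplex.
split; last 2 first.
- by move=> s A _; exact: uniform_markov_row_perm.
- by move=> s A _; exact: uniform_markov_col_perm.
- move=> d T P M _; split=> [lawM|[[indM _] dirM] A mA]; last first.
    rewrite -U_uniform//; apply: corner_unique mA => [|t].
      by apply: le_lt_trans (probability_le1 _ _) (ltry _).
    apply: etrans _ (esym (U_corner t)); rewrite /distribution /pushforward.
    move/independent_RVsP : indM => /(_ (fun i => corner (row i t))
      (fun i => measurable_corner _)).
    rewrite (_ : [set w | _] = M @^-1` corner t); last first.
      by apply/seteqP; split=> w /corner_rows.
    move=> PE; apply: etrans PE _; rewrite -prodEFin; apply: eq_bigr => i _.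
    by rewrite -D_corner; exact: ((dirP _).1 (dirM i) _ (measurable_corner _)).
  (* A model with independent rows of law [D]: agreement of [M] and [M'] on corners extends to all
     Borel sets, and so gives [M] the product formula for arbitrary row events. *)
  have [d' [T' [P' [M' M'rows]]]] := iid_rows_ex n D.
  have lawMM' A : measurable A -> P (M @^-1` A) = P' (M' @^-1` A).
    move=> mA; rewrite -[LHS]/(distribution P M A) lawM// -U_uniform//.
    apply/esym; apply: (corner_unique (mu := distribution P' M')) mA => [|t].
      by apply: le_lt_trans (probability_le1 _ _) (ltry _).
    apply: etrans _ (esym (U_corner t)); rewrite /distribution /pushforward.
    have := M'rows (fun i => corner (row i t)) (fun i => measurable_corner _).
    rewrite (_ : [set w | _] = M' @^-1` corner t); last first.
      by apply/seteqP; split=> w /corner_rows.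
    move=> PE; apply: etrans PE _; rewrite -prodEFin.
    by apply: eq_bigr => i _; exact: D_corner.
  have Mrows (B : 'I_n -> set (borel_mx R 1 n)) : (forall i, measurable (B i)) ->
      P [set w | forall i, B i (random_row M i w)] = (\prod_i D (B i))%E.
    move=> mB; rewrite -M'rows//.
    have := lawMM' [set z | forall i, B i (row i (z : 'M[R]_n))].
    apply; rewrite (_ : [set z | _] = \bigcap_(i in setT) (row i @^-1` B i)).
      apply: fin_bigcap_measurable => // i _.
      by rewrite -[X in measurable X]setTI; exact: measurable_row.
    by apply/seteqP; split=> z /= H i; [move=> _|]; exact: H.
  (* The law of one row is the product formula with the other rows unconstrained. *)
  have rowD i B : measurable B -> P (random_row M i @^-1` B) = D B.
    move=> mB; pose C k := if k == i then B else setT.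
    have mC k : measurable (C k) by rewrite /C; case: ifP.
    have := Mrows C mC; rewrite (bigD1 i)//= [X in (_ * X)%E]big1 => [|k /negbTE ki].
      rewrite mule1 /C eqxx => <-; congr (P _); apply/seteqP; split=> w /= H.
        by move=> k; case: eqP => [->|].
      by have := H i; rewrite eqxx.
    by rewrite /C ki; exact: probability_setT.
  split; last by move=> i; apply/dirP => B mB; exact: rowD.
  split; last by move=> i k B mB; rewrite /distribution /pushforward !rowD.
  apply/independent_RVsP => B mB; rewrite Mrows//.
  by apply: eq_bigr => i _; rewrite rowD.
- move=> d T P X /dirP lawX j; rewrite -(flat_dirichlet_mean n_ge1 D_corner D_simplex j).
  rewrite unlock.
  have mcoord := @measurable_coord R 1 n ord0 j.
  transitivity (\int[distribution P X]_x ((x : 'rV[R]_n) ord0 j)%:E)%E; last first.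
    by apply: eq_measure_integral => A mA _; exact: lawX.
  (* Change of variables, on positive and negative parts separately. *)
  rewrite [LHS]integralE [RHS]integralE; congr (_ - _)%E.
    rewrite [RHS]ge0_integral_distribution//.
      by apply: eq_integral => w _; rewrite /= !funeposE.
    by apply: measurable_funepos; exact/measurable_EFinP.
  rewrite [RHS]ge0_integral_distribution//.
    by apply: eq_integral => w _; rewrite /= !funenegE.
  by apply: measurable_funeneg; exact/measurable_EFinP.
Qed.
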